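(* Let $\mathcal N=(\hat{\mathcal K},\hat{\mathcal B})$ be a model of $T^R$, $A\subseteq\hat{\mathcal K}$ and $\mathbf b\in\hat{\mathcal K}$. Then $\mathbf b$ is definable over $A$ in $\mathcal N$ if and only if $\mathbf b=\lim_{m\to\infty}\mathbf b_m$ (in the metric $d_{\mathbb K}$) for some sequence of elements $\mathbf b_m\in\hat{\mathcal K}$, each of which is first-order definable over $A$. Thus $\mathrm{dcl}(A)=\mathrm{cl}(\mathrm{fdcl}(A))$.
   Context: $L$ is a finite or countable first-order signature and $T$ is a complete first-order $L$-theory all of whose models have at least two elements. The randomization signature $L^R$ is the two-sorted continuous-logic signature with a sort $\mathbb K$ (random elements) and a sort $\mathbb B$ (events). It has: for each first-order $L$-formula $\varphi$ with $n$ free variables, a function symbol $[\![\varphi(\cdot)]\!]$ of sort $\mathbb K^n\to\mathbb B$; a $[0,1]$-valued predicate $\mu$ on $\mathbb B$; the Boolean operations $\top,\bot,\sqcap,\sqcup,\neg$ on $\mathbb B$; and distance predicates $d_{\mathbb B}$ and $d_{\mathbb K}$. Given $\mathcal M\models T$, a nice randomization of $\mathcal M$ is a pre-structure $(\mathcal K,\mathcal B)$ for $L^R$ with an atomless probability space $(\Omega,\mathcal B,\mu)$ satisfying the following. (i) $\mathcal B$ is a $\sigma$-algebra on $\Omega$, with the Boolean operations interpreted set-theoretically. (ii) $\mathcal K$ is a set of functions $\Omega\to M$. (iii) For each formula $\psi$ and tuple $\vec a$ from $\mathcal K$, $[\![\psi(\vec a)]\!]=\{\omega:\mathcal M\models\psi(\vec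 a(\omega))\}\in\mathcal B$. (iv) $\mathcal B$ consists exactly of such events. (v) For each $\theta(u,\vec v)$ and $\vec b$ from $\mathcal K$, there is $a\in\mathcal K$ with $[\![\theta(a,\vec b)]\!]=[\![(\exists u\,\theta)(\vec b)]\!]$. (vi) $d_{\mathbb K}(a,b)=\mu[\![a\ne b]\!]$. (vii) $d_{\mathbb B}(\mathsf B,\mathsf C)=\mu(\mathsf B\triangle\mathsf C)$. In addition, the reduction of the pre-structure (identifying elements at distance $0$) is already complete. $T^R$ is the set of continuous $L^R$-sentences true in all nice randomizations of models of $T$. A model of $T^R$ is written $\mathcal N=(\hat{\mathcal K},\hat{\mathcal B})$, with sort-$\mathbb K$ part $\hat{\mathcal K}$ and sort-$\mathbb B$ part $\hat{\mathcal B}$. In a continuous structure, an element $b$ is definable over $A$ if there are continuous formulas $\Phi_k(x,\vec a_k)$, with $\vec a_k$ tuples from $A$, whose values converge uniformly in $x$ to $d(x,b)$. $\mathrm{dcl}(A)$ is the set of elements of $\hat{\mathcal K}$ definable over $A$ in $\mathcal N$. A first-order formula $\varphi(u,\vec v)$ is functional if $T\models(\forall\vec v)(\exists^{\le1}u)\varphi(u,\vec v)$. An element $\mathbf b\in\hat{\mathcal K}$ is first-order definable over $A\subseteq\hat{\mathcal K}$ (written $\mathbf b\in\mathrm{fdcl}(A)$) if there are a functional formula $\varphi(u,\vec v)$ and a tuple $\vec{\mathbf a}$ from $A$ with $[\![\varphi(\mathbf b,\vec{\mathbf a})]\!]=\top$. $\mathrm{cl}$ denotes closure in the metric $d_{\mathbb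 K}$. *)

(* Defs.v *)
From HB Require Import structures.
From mathcomp Require Import all_boot all_order all_algebra.
From mathcomp Require Import all_classical all_reals all_analysis.

Set Implicit Arguments.
Unset Strict Implicit.
Unset Printing Implicit Defensive.

Import Order.TTheory GRing.Theory Num.Theory.
Import numFieldNormedType.Exports.

Local Open Scope classical_set_scope.
Local Open Scope ring_scope.

(* An n-tuple of elements of X is a function 'I_n -> X. *)

Definition tnil {X : Type} (i : 'I_0) : X := False_rect X (notF (ltn_ord i)).

Definition tcons {X : Type} {n : nat} (x : X) (v : 'I_n -> X) : 'I_n.+1 -> X :=
  fun i => oapp v x (unlift ord0 i).

Record signature := Signature {
  fsym : countType;
  rsym : countType;
  far : fsym -> nat;
  rar : rsym -> nat }.

Inductive term (L : signature) (n : nat) : Type :=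
| TVar of 'I_n
| TApp (f : fsym L) (ts : 'I_(far f) -> term L n).

(* [formula L n]: formulas with free variables among v_0, ..., v_(n-1).  A
   quantifier binds v_0 of its body and shifts the other variables by one. *)
Inductive formula (L : signature) : nat -> Type :=
| FFalse n : formula L n
| FEq n of term L n & term L n : formula L n
| FRel n (r : rsym L) (ts : 'I_(rar r) -> term L n) : formula L n
| FNot n of formula L n : formula L n
| FAnd n of formula L n & formula L n : formula L n
| FOr n of formula L n & formula L n : formula L n
| FImp n of formula L n & formula L n : formula L n
| FAll n of formula L n.+1 : formula L n
| FEx n of formula L n.+1 : formula L n.

Record structure (L : signature) := Structure {
  carrier :> Type;
  carrier_inhabited : inhabited carrier;
  finterp : forall f : fsym L, ('I_(far f) -> carrier) -> carrier;
  rinterp : forall r : rsym L, ('I_(rar r) -> carrier) -> Prop }.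

Fixpoint teval (L : signature) (M : structure L) n (v : 'I_n -> M)
    (t : term L n) : M :=
  match t with
  | TVar i => v i
  | TApp f ts => finterp (fun i => teval v (ts i))
  end.

Fixpoint sat (L : signature) (M : structure L) n (phi : formula L n) :
    ('I_n -> M) -> Prop :=
  match phi in formula _ n return ('I_n -> M) -> Prop with
  | FFalse _ => fun _ => False
  | FEq _ s t => fun v => teval v s = teval v t
  | FRel _ r ts => fun v => rinterp (fun i => teval v (ts i))
  | FNot _ p => fun v => ~ sat p v
  | FAnd _ p q => fun v => sat p v /\ sat q v
  | FOr _ p q => fun v => sat p v \/ sat q v
  | FImp _ p q => fun v => sat p v -> sat q v
  | FAll _ p => fun v => forall x, sat p (tcons x v)
  | FEx _ p => fun v => exists x, sat p (tcons x v)
  end.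

Definition theory (L : signature) := set (formula L 0).

Definition is_model (L : signature) (T : theory L) (M : structure L) : Prop :=
  forall phi, T phi -> sat phi (@tnil M).

Definition entails (L : signature) (T : theory L) (phi : formula L 0) : Prop :=
  forall M, is_model T M -> sat phi (@tnil M).

Definition complete_theory (L : signature) (T : theory L) : Prop :=
  (exists M, is_model T M) /\
  forall phi, entails T phi \/ entails T (FNot phi).

Definition models_nontrivial (L : signature) (T : theory L) : Prop :=
  forall M, is_model T M -> exists x y : M, x <> y.

(* T |= (forall v)(exists^{<= 1} u) phi(u, v), where u is the variable v_0. *)
Definition functional (L : signature) (T : theory L) n
    (phi : formula L n.+1) : Prop :=
  forall M, is_model T M -> forall (v : 'I_n -> M) (u u' : M),
    sat phi (tcons u v) -> sat phi (tcons u' v) -> u = u'.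

Definition unit_cube (R : realType) n : set 'rV[R]_n :=
  [set x | forall i, 0 <= x 0 i <= 1].

Record connective (R : realType) n := Connective {
  conn_fun :> 'rV[R]_n -> R;
  conn_continuous : {within @unit_cube R n, continuous conn_fun};
  conn_unit : forall x, unit_cube x -> 0 <= conn_fun x <= 1 }.

(* Terms of sort B, in k variables of sort K and l variables of sort B.  The
   only terms of sort K are variables. *)
Inductive bterm (L : signature) (k l : nat) : Type :=
| BVar of 'I_l
| BEvent n (phi : formula L n) (s : 'I_n -> 'I_k)
| BTop
| BBot
| BMeet of bterm L k l & bterm L k l
| BJoin of bterm L k l & bterm L k l
| BCompl of bterm L k l.

(* As in [formula], a quantifier over a sort binds variable 0 of that sort. *)
Inductive cformula (R : realType) (L : signature) : nat -> nat -> Type :=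
| CMu k l of bterm L k l : cformula R L k l
| CDistB k l of bterm L k l & bterm L k l : cformula R L k l
| CDistK k l of 'I_k & 'I_k : cformula R L k l
| CConn k l n (u : connective R n) (Phis : 'I_n -> cformula R L k l) :
    cformula R L k l
| CSupK k l of cformula R L k.+1 l : cformula R L k l
| CInfK k l of cformula R L k.+1 l : cformula R L k l
| CSupB k l of cformula R L k l.+1 : cformula R L k l
| CInfB k l of cformula R L k l.+1 : cformula R L k l.

Record rand_interp (R : realType) (L : signature) := RandInterp {
  sortK : Type;
  sortB : Type;
  event : forall n, formula L n -> ('I_n -> sortK) -> sortB;
  mu : sortB -> R;
  btop : sortB;
  bbot : sortB;
  bmeet : sortB -> sortB -> sortB;
  bjoin : sortB -> sortB -> sortB;
  bcompl : sortB -> sortB;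
  distB : sortB -> sortB -> R;
  distK : sortK -> sortK -> R }.

Fixpoint bval (R : realType) (L : signature) (N : rand_interp R L) k l
    (x : 'I_k -> sortK N) (y : 'I_l -> sortB N) (t : bterm L k l) : sortB N :=
  match t with
  | BVar i => y i
  | BEvent _ phi s => event phi (fun i => x (s i))
  | BTop => btop N
  | BBot => bbot N
  | BMeet t1 t2 => bmeet (bval x y t1) (bval x y t2)
  | BJoin t1 t2 => bjoin (bval x y t1) (bval x y t2)
  | BCompl t1 => bcompl (bval x y t1)
  end.

Fixpoint cval (R : realType) (L : signature) (N : rand_interp R L) k l
    (Phi : cformula R L k l) : ('I_k -> sortK N) -> ('I_l -> sortB N) -> R :=
  match Phi in cformula _ _ k l
        return ('I_k -> sortK N) -> ('I_l -> sortB N) -> R with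
  | CMu _ _ t => fun x y => mu (bval x y t)
  | CDistB _ _ s t => fun x y => distB (bval x y s) (bval x y t)
  | CDistK _ _ i j => fun x y => distK (x i) (x j)
  | CConn _ _ _ u Phis => fun x y => u (\row_i cval (Phis i) x y)
  | CSupK _ _ P => fun x y => sup (range (fun a => cval P (tcons a x) y))
  | CInfK _ _ P => fun x y => inf (range (fun a => cval P (tcons a x) y))
  | CSupB _ _ P => fun x y => sup (range (fun e => cval P x (tcons e y)))
  | CInfB _ _ P => fun x y => inf (range (fun e => cval P x (tcons e y)))
  end.

Definition is_pseudometric (R : realType) (X : Type) (d : X -> X -> R) : Prop :=
  [/\ forall x y, 0 <= d x y <= 1,
      forall x, d x x = 0,
      forall x y, d x y = d y x &
      forall x y z, d x z <= d x y + d y z].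

Definition separated (R : realType) (X : Type) (d : X -> X -> R) : Prop :=
  forall x y, d x y = 0 -> x = y.

(* For a pseudometric d this says that the quotient metric space, obtained by
   identifying points at distance 0, is complete. *)
Definition dist_complete (R : realType) (X : Type) (d : X -> X -> R) : Prop :=
  forall u : nat -> X,
    (forall e : R, 0 < e ->
       exists n, forall i j, (n <= i)%N -> (n <= j)%N -> d (u i) (u j) < e) ->
    exists x, d (u i) x @[i --> \oo] --> (0 : R).

(* The moduli of uniform continuity of the symbols are the Lipschitz bounds
   satisfied by every randomization.  d_B and d_K, being pseudometrics, are
   automatically uniformly continuous. *)
Definition is_prestructure (R : realType) (L : signature)
    (N : rand_interp R L) : Prop :=
  [/\ inhabited (sortK N),
      is_pseudometric (@distK R L N),
      is_pseudometric (@distB R L N),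
      forall B : sortB N, 0 <= mu B <= 1 &
      [/\ forall B C : sortB N, `|mu B - mu C| <= distB B C,
          forall B C : sortB N, distB (bcompl B) (bcompl C) <= distB B C,
          forall B C B' C' : sortB N,
            distB (bmeet B C) (bmeet B' C') <= distB B B' + distB C C',
          forall B C B' C' : sortB N,
            distB (bjoin B C) (bjoin B' C') <= distB B B' + distB C C' &
          forall n (phi : formula L n) (a b : 'I_n -> sortK N),
            distB (event phi a) (event phi b) <= \sum_i distK (a i) (b i)]].

Definition is_metric_structure (R : realType) (L : signature)
    (N : rand_interp R L) : Prop :=
  [/\ is_prestructure N,
      separated (@distK R L N) /\ separated (@distB R L N),
      dist_complete (@distK R L N) &
      dist_complete (@distB R L N)].

Definition atomless (R : realType) (d : measure_display)
    (Omega : measurableType d) (P : probability Omega R) : Prop :=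
  forall A : set Omega, measurable A -> (0 < P A)%E ->
    exists B : set Omega,
      [/\ measurable B, B `<=` A, (0 < P B)%E & (P B < P A)%E].

Definition random_event (L : signature) (M : structure L) (Omega : Type) n
    (phi : formula L n) (a : 'I_n -> Omega -> M) : set Omega :=
  [set w | sat phi (fun i => a i w)].

Record randomization (R : realType) (L : signature) (M : structure L) :=
  Randomization {
  rdisp : measure_display;
  romega : measurableType rdisp;
  rprob : probability romega R;
  rK : set (romega -> M);
  rmeasurable : forall n (phi : formula L n) (a : 'I_n -> romega -> M),
    (forall i, rK (a i)) -> measurable (random_event phi a) }.

Section RandomizationInterp.
Variables (R : realType) (L : signature) (M : structure L).
Variable X : randomization R M.

Definition rand_sortK := {a : romega X -> M | rK a}.
Definition rand_sortB := {B : set (romega X) | measurable B}.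

Definition rand_event n (phi : formula L n) (a : 'I_n -> rand_sortK) :
    rand_sortB :=
  exist _ _ (rmeasurable phi (fun i => proj2_sig (a i))).

Definition rand_meet (B C : rand_sortB) : rand_sortB :=
  exist _ _ (measurableI _ _ (proj2_sig B) (proj2_sig C)).

Definition rand_join (B C : rand_sortB) : rand_sortB :=
  exist _ _ (measurableU _ _ (proj2_sig B) (proj2_sig C)).

Definition rand_compl (B : rand_sortB) : rand_sortB :=
  exist _ _ (measurableC (proj2_sig B)).

Definition randomization_interp : rand_interp R L := {|
  sortK := rand_sortK;
  sortB := rand_sortB;
  event := rand_event;
  mu := fun B => fine (rprob X (proj1_sig B));
  btop := exist _ setT measurableT;
  bbot := exist _ set0 measurable0;
  bmeet := rand_meet;
  bjoin := rand_join;
  bcompl := rand_compl;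
  distB := fun B C => fine (rprob X (proj1_sig B `+` proj1_sig C));
  distK := fun a b =>
    fine (rprob X [set w | proj1_sig a w <> proj1_sig b w]) |}.

End RandomizationInterp.

Definition nice (R : realType) (L : signature) (M : structure L)
    (X : randomization R M) : Prop :=
  [/\ is_prestructure (randomization_interp X),
      atomless (rprob X),
      forall B : set (romega X), measurable B ->
        exists n (psi : formula L n) (a : 'I_n -> romega X -> M),
          (forall i, rK (a i)) /\ B = random_event psi a,
      forall n (theta : formula L n.+1) (b : 'I_n -> romega X -> M),
        (forall i, rK (b i)) ->
        exists2 a, rK a &
          random_event theta (tcons a b) = random_event (FEx theta) b &
      dist_complete (@distK R L (randomization_interp X)) /\
      dist_complete (@distB R L (randomization_interp X))].

Definition csentence (R : realType) (L : signature) := cformula R L 0 0.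

(* A continuous sentence is true when its value is 0. *)
Definition ctrue (R : realType) (L : signature) (N : rand_interp R L)
    (Phi : csentence R L) : Prop :=
  cval Phi (@tnil (sortK N)) (@tnil (sortB N)) = 0.

Definition TR (R : realType) (L : signature) (T : theory L) :
    set (csentence R L) :=
  [set Phi | forall (M : structure L) (X : randomization R M),
     is_model T M -> nice X -> ctrue (randomization_interp X) Phi].

Arguments TR R {L} T.

Definition is_model_TR (R : realType) (L : signature) (T : theory L)
    (N : rand_interp R L) : Prop :=
  is_metric_structure N /\ forall Phi, TR R T Phi -> ctrue N Phi.

Section Closures.
Variables (R : realType) (L : signature) (T : theory L) (N : rand_interp R L).

Definition definable (A : set (sortK N)) (b : sortK N) : Prop :=
  exists (n : nat -> nat) (Phi : forall k, cformula R L (n k).+1 0)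
         (a : forall k, 'I_(n k) -> sortK N),
    (forall k i, A (a k i)) /\
    forall e : R, 0 < e -> \forall k \near \oo, forall x : sortK N,
      `|cval (Phi k) (tcons x (a k)) (@tnil (sortB N)) - distK x b| < e.

Definition dcl (A : set (sortK N)) : set (sortK N) :=
  [set b | definable A b].

Definition fo_definable (A : set (sortK N)) (b : sortK N) : Prop :=
  exists n (phi : formula L n.+1) (a : 'I_n -> sortK N),
    [/\ functional T phi, forall i, A (a i) &
        event phi (tcons b a) = btop N].

Definition fdcl (A : set (sortK N)) : set (sortK N) :=
  [set b | fo_definable A b].

Definition cl (S : set (sortK N)) : set (sortK N) :=
  [set b | forall e : R, 0 < e -> exists2 a, S a & distK a b < e].

End Closures.

(* Main.v *)
(* For a functional formula phi with [[phi(b, a)]] = T, the distance d(x, b) is the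
   probability that phi(x, a) fails, so limits of first-order definable elements
   are definable.

   Conversely, in a nice randomization the value of a continuous formula Phi(x, a)
   depends only on the law of a finite first-order classification of the points
   (x(w), a(w)): quantifiers are eliminated by a back-and-forth argument that
   splits events of the atomless space.  If Phi(x, a) is uniformly close to
   d(x, b), then every x such that (x, a) has the same law as (b, a) is close to
   b.  Comparing b with a conditionally independent copy of itself, one sees that,
   up to a small event, b(w) is the only point in its class, and that this class
   is a function of the first-order type of a(w).  So b almost satisfies one of
   finitely many functional formulas that depend on Phi alone.  This finiteness
   turns the conclusion into a sentence of T^R, which transfers to every model;
   there, completeness provides exact solutions of functional formulas. *)

Require Import Defs.
From mathcomp Require Import all_boot all_order all_algebra.
From mathcomp Require Import all_classical all_reals all_analysis.
From mathcomp Require Import lra zify.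

Set Implicit Arguments.
Unset Strict Implicit.
Unset Printing Implicit Defensive.

Import Order.TTheory GRing.Theory Num.Theory.
Import numFieldNormedType.Exports.

Local Open Scope classical_set_scope.
Local Open Scope ring_scope.

(** * Renaming of variables and first-order definable relations *)

Lemma tcons0 (X : Type) n (x : X) (v : 'I_n -> X) : tcons x v ord0 = x.
Proof. by rewrite /tcons unlift_none. Qed.

Lemma tconsS (X : Type) n (x : X) (v : 'I_n -> X) i :
  tcons x v (lift ord0 i) = v i.
Proof. by rewrite /tcons liftK. Qed.

Lemma tcons_tail (X : Type) n (x : X) (v : 'I_n -> X) :
  (fun i => tcons x v (lift ord0 i)) = v.
Proof. by apply/funext => i; rewrite tconsS. Qed.

Lemma tcons_comp (X Y : Type) (f : X -> Y) n (x : X) (v : 'I_n -> X) :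
  (fun i => f (tcons x v i)) = tcons (f x) (fun i => f (v i)).
Proof. by apply/funext => i; rewrite /tcons; case: unlift. Qed.

Lemma tcons_eta (X : Type) n (v : 'I_n.+1 -> X) :
  tcons (v ord0) (fun i => v (lift ord0 i)) = v.
Proof.
by apply/funext => i; rewrite /tcons; case: unliftP => [j ->|->].
Qed.

Lemma tnil_uniq (X : Type) (v : 'I_0 -> X) : v = @tnil X.
Proof. by apply/funext => -[]. Qed.

Definition rup n m (s : 'I_n -> 'I_m) : 'I_n.+1 -> 'I_m.+1 :=
  tcons ord0 (fun i => lift ord0 (s i)).

Lemma tcons_rup (X : Type) n m (s : 'I_n -> 'I_m) (x : X) (v : 'I_m -> X) :
  (fun i => tcons x v (rup s i)) = tcons x (fun i => v (s i)).
Proof.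
rewrite /rup tcons_comp tcons0; congr tcons.
by apply/funext => i; rewrite tconsS.
Qed.

Fixpoint trename (L : signature) n m (s : 'I_n -> 'I_m) (t : term L n) :
    term L m :=
  match t with
  | TVar i => TVar L (s i)
  | TApp f ts => TApp (fun i => trename s (ts i))
  end.

Lemma teval_rename (L : signature) (M : structure L) n m (s : 'I_n -> 'I_m)
    (v : 'I_m -> M) (t : term L n) :
  teval v (trename s t) = teval (fun i => v (s i)) t.
Proof.
by elim: t => [i|f ts IH] //=; congr finterp; apply/funext => i; apply: IH.
Qed.

Fixpoint frename (L : signature) n (phi : formula L n) :
    forall m, ('I_n -> 'I_m) -> formula L m :=
  match phi in formula _ n return forall m, ('I_n -> 'I_m) -> formula L m with
  | FFalse _ => fun m _ => FFalse L m
  | FEq _ t u => fun m s => FEq (trename s t) (trename s u)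
  | FRel _ r ts => fun m s => FRel (fun i => trename s (ts i))
  | FNot _ p => fun m s => FNot (frename p s)
  | FAnd _ p q => fun m s => FAnd (frename p s) (frename q s)
  | FOr _ p q => fun m s => FOr (frename p s) (frename q s)
  | FImp _ p q => fun m s => FImp (frename p s) (frename q s)
  | FAll _ p => fun m s => FAll (frename p (rup s))
  | FEx _ p => fun m s => FEx (frename p (rup s))
  end.

Lemma sat_rename (L : signature) (M : structure L) n (phi : formula L n) m
    (s : 'I_n -> 'I_m) (v : 'I_m -> M) :
  sat (frename phi s) v = sat phi (fun i => v (s i)).
Proof.
elim: phi m s v => {n} [//|n t u|n r ts|n p IH|n p IHp q IHq|n p IHp q IHq
  |n p IHp q IHq|n p IH|n p IH] m s v /=.
- by rewrite !teval_rename.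
- by congr rinterp; apply/funext => i; rewrite teval_rename.
- by rewrite IH.
- by rewrite IHp IHq.
- by rewrite IHp IHq.
- by rewrite IHp IHq.
- rewrite propeqE; split=> H x; first by have := H x; rewrite IH tcons_rup.
  by rewrite IH tcons_rup.
- rewrite propeqE; split=> -[x H]; exists x; move: H; rewrite IH tcons_rup //.
Qed.

Fixpoint brename (L : signature) k k' l (s : 'I_k -> 'I_k')
    (t : bterm L k l) : bterm L k' l :=
  match t with
  | BVar j => BVar L k' j
  | BEvent _ phi r => BEvent l phi (fun i => s (r i))
  | BTop => BTop L k' l
  | BBot => BBot L k' l
  | BMeet t1 t2 => BMeet (brename s t1) (brename s t2)
  | BJoin t1 t2 => BJoin (brename s t1) (brename s t2)
  | BCompl t1 => BCompl (brename s t1)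
  end.

Lemma bval_rename (R : realType) (L : signature) (N : rand_interp R L) k k' l
    (s : 'I_k -> 'I_k') (t : bterm L k l) x (y : 'I_l -> sortB N) :
  bval x y (brename s t) = bval (fun i => x (s i)) y t.
Proof.
elim: t => //= [t1 -> t2 ->|t1 -> t2 ->|t ->] //.
Qed.

Fixpoint crename (R : realType) (L : signature) k l (Phi : cformula R L k l) :
    forall k', ('I_k -> 'I_k') -> cformula R L k' l :=
  match Phi in cformula _ _ k l
    return forall k', ('I_k -> 'I_k') -> cformula R L k' l with
  | CMu _ _ t => fun k' s => CMu R (brename s t)
  | CDistB _ _ t u => fun k' s => CDistB R (brename s t) (brename s u)
  | CDistK _ l i j => fun k' s => CDistK R L l (s i) (s j)
  | CConn _ _ _ u Phis => fun k' s => CConn u (fun i => crename (Phis i) s)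
  | CSupK _ _ P => fun k' s => CSupK (crename P (rup s))
  | CInfK _ _ P => fun k' s => CInfK (crename P (rup s))
  | CSupB _ _ P => fun k' s => CSupB (crename P s)
  | CInfB _ _ P => fun k' s => CInfB (crename P s)
  end.

Lemma cval_rename (R : realType) (L : signature) (N : rand_interp R L) k l
    (Phi : cformula R L k l) k' (s : 'I_k -> 'I_k') x (y : 'I_l -> sortB N) :
  cval (crename Phi s) x y = cval Phi (fun i => x (s i)) y.
Proof.
elim: Phi k' s x y => {k l} [k l t|k l t u|k l i j|k l n u Ps IH|k l P IH
  |k l P IH|k l P IH|k l P IH] k' s x y //=.
- by rewrite bval_rename.
- by rewrite !bval_rename.
- by congr (u _); apply/rowP => i; rewrite !mxE IH.
- by congr sup; apply: eq_imagel => a _; rewrite IH tcons_rup.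
- by congr inf; apply: eq_imagel => a _; rewrite IH tcons_rup.
- by congr sup; apply: eq_imagel => a _; rewrite IH.
- by congr inf; apply: eq_imagel => a _; rewrite IH.
Qed.

Definition fodef (L : signature) n
    (P : forall M : structure L, ('I_n -> M) -> Prop) : Prop :=
  exists phi : formula L n, forall M v, sat phi v <-> P M v.

Lemma fodef_iff (L : signature) n
    (P Q : forall M : structure L, ('I_n -> M) -> Prop) :
  (forall M v, P M v <-> Q M v) -> fodef P -> fodef Q.
Proof.
by move=> PQ [phi H]; exists phi => M v; apply: (iff_trans (H M v)).
Qed.

Lemma fodef_sat (L : signature) n (phi : formula L n) :
  fodef (fun M v => @sat L M n phi v).
Proof. by exists phi. Qed.

Lemma fodef_const (L : signature) n (Q : Prop) :
  @fodef L n (fun _ _ => Q).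
Proof.
case: (pselect Q) => q; last by exists (FFalse L n).
by exists (FNot (FFalse L n)) => M v /=; split => // _ [].
Qed.

Lemma fodef_not (L : signature) n
    (P : forall M : structure L, ('I_n -> M) -> Prop) :
  fodef P -> fodef (fun M v => ~ P M v).
Proof. by case=> p Hp; exists (FNot p) => M v /=; rewrite Hp. Qed.

Lemma fodef_and (L : signature) n
    (P Q : forall M : structure L, ('I_n -> M) -> Prop) :
  fodef P -> fodef Q -> fodef (fun M v => P M v /\ Q M v).
Proof.
by case=> p Hp [q Hq]; exists (FAnd p q) => M v /=; rewrite Hp Hq.
Qed.

Lemma fodef_or (L : signature) n
    (P Q : forall M : structure L, ('I_n -> M) -> Prop) :
  fodef P -> fodef Q -> fodef (fun M v => P M v \/ Q M v).
Proof.
by case=> p Hp [q Hq]; exists (FOr p q) => M v /=; rewrite Hp Hq.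
Qed.

Lemma fodef_imp (L : signature) n
    (P Q : forall M : structure L, ('I_n -> M) -> Prop) :
  fodef P -> fodef Q -> fodef (fun M v => P M v -> Q M v).
Proof.
by case=> p Hp [q Hq]; exists (FImp p q) => M v /=; rewrite Hp Hq.
Qed.

Lemma fodef_ex (L : signature) n
    (P : forall M : structure L, ('I_n.+1 -> M) -> Prop) :
  fodef P -> fodef (fun M v => exists x, P M (tcons x v)).
Proof.
case=> p Hp; exists (FEx p) => M v /=.
by split=> -[x H]; exists x; apply/Hp.
Qed.

Lemma fodef_all (L : signature) n
    (P : forall M : structure L, ('I_n.+1 -> M) -> Prop) :
  fodef P -> fodef (fun M v => forall x, P M (tcons x v)).
Proof.
case=> p Hp; exists (FAll p) => M v /=.
by split=> H x; apply/Hp.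
Qed.

Lemma fodef_eq (L : signature) n (i j : 'I_n) :
  fodef (fun (M : structure L) v => v i = v j).
Proof. by exists (FEq (TVar L i) (TVar L j)). Qed.

Lemma fodef_rename (L : signature) n m (s : 'I_n -> 'I_m)
    (P : forall M : structure L, ('I_n -> M) -> Prop) :
  fodef P -> fodef (fun M v => P M (fun i => v (s i))).
Proof.
by case=> p Hp; exists (frename p s) => M v; rewrite sat_rename.
Qed.

Lemma fodef_exfin (L : signature) n (C : finType)
    (P : C -> forall M : structure L, ('I_n -> M) -> Prop) :
  (forall c, fodef (P c)) -> fodef (fun M v => exists c, P c M v).
Proof.
move=> HP.
suff H (s : seq C) : fodef (fun M v => exists2 c, c \in s & P c M v).
  apply: fodef_iff (H (enum C)) => M v; split=> -[c]; first by exists c.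
  by exists c => //; rewrite mem_enum.
elim: s => [|c s IH].
  by apply: (fodef_iff _ (fodef_const L n False)) => M v; split=> // -[].
apply: fodef_iff (fodef_or (HP c) IH) => M v; split.
  case=> [H|[d ds H]]; first by exists c => //; rewrite mem_head.
  by exists d => //; rewrite inE ds orbT.
case=> d; rewrite inE => /orP[/eqP -> H|ds H]; first by left.
by right; exists d.
Qed.

Lemma fodef_allfin (L : signature) n (C : finType)
    (P : C -> forall M : structure L, ('I_n -> M) -> Prop) :
  (forall c, fodef (P c)) -> fodef (fun M v => forall c, P c M v).
Proof.
move=> HP; have := fodef_not (fodef_exfin (fun c => fodef_not (HP c))).
apply: fodef_iff => M v; split=> [H c|H [c]]; last exact.
by apply: contrapT => nP; apply: H; exists c.
Qed.

(* A finite partition of the n-tuples of every L-structure into classes defined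
   by first-order formulas that do not depend on the structure. *)
Record classifier (L : signature) (n : nat) := Classifier {
  cls : finType;
  cmap :> forall M : structure L, ('I_n -> M) -> cls;
  cmap_def : forall c, fodef (fun M v => cmap v = c) }.

Lemma fodef_cmap (L : signature) n (g : classifier L n) (Q : cls g -> Prop) :
  fodef (fun M v => Q (g M v)).
Proof.
have := fodef_exfin (fun c => fodef_and (fodef_const L n (Q c)) (cmap_def c)).
by apply: fodef_iff => M v; split=> [[c [Qc ->]]|H] //; exists (g M v).
Qed.

Lemma set_classifier (L : signature) n (C : finType)
    (P : C -> forall M : structure L, ('I_n -> M) -> Prop) :
  (forall c, fodef (P c)) ->
  forall d, fodef (fun M v => [set c | `[< P c M v >]]%SET = d).
Proof.
move=> HP d.
have H c : fodef (fun M v => `[< P c M v >] = (c \in d)).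
  have := HP c; case: (c \in d).
    by apply: fodef_iff => M v; split=> /asboolP.
  move=> /fodef_not; apply: fodef_iff => M v.
  by split=> [/asboolPn/negbTE|/negbT/asboolPn].
apply: fodef_iff (fodef_allfin H) => M v; split=> [E|<- c]; last by rewrite inE.
by apply/setP => c; rewrite inE E.
Qed.

Lemma fodef_classifier (L : signature) n
    (P : forall M : structure L, ('I_n -> M) -> Prop) :
  fodef P -> exists (g : classifier L n) (h : cls g -> bool),
    forall M v, h (g M v) <-> P M v.
Proof.
move=> defP.
have def (c : {set 'I_1}) :
    fodef (fun M v => [set _ | `[< P M v >]]%SET = c).
  exact: set_classifier.
exists (Classifier def), (fun c : {set 'I_1} => ord0 \in c) => M v /=.
by rewrite inE; split=> /asboolP.
Qed.

Lemma pair_classifier (L : signature) n (g h : classifier L n) c :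
  fodef (fun M v => (g M v, h M v) = c).
Proof.
case: c => c d; apply: fodef_iff (fodef_and (cmap_def c) (cmap_def d)) => M v.
by split=> [[-> ->]|[-> ->]].
Qed.

Lemma ffun_classifier (L : signature) n m (g : 'I_m -> classifier L n)
    (c : {dffun forall i, cls (g i)}) :
  fodef (fun M v => [ffun i => g i M v] = c).
Proof.
apply: fodef_iff (fodef_allfin (fun i => cmap_def (c i))) => M v.
by split=> [H|<- i]; [apply/ffunP => i; rewrite ffunE H|rewrite ffunE].
Qed.

Definition prodC (L : signature) n (g h : classifier L n) :=
  Classifier (@pair_classifier L n g h).

Definition ffunC (L : signature) n m (g : 'I_m -> classifier L n) :=
  Classifier (@ffun_classifier L n m g).

(** * Atomless probability spaces *)

Definition pr (R : realType) d (Omega : measurableType d)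
    (P : probability Omega R) (A : set Omega) : R := fine (P A).

Section Probability.
Context (R : realType) (d : measure_display) (Omega : measurableType d).
Context (P : probability Omega R).

Lemma prE A : measurable A -> P A = (pr P A)%:E.
Proof. by move=> mA; rewrite /pr fineK // fin_num_measure. Qed.

Lemma pr_ge0 A : 0 <= pr P A.
Proof. by rewrite /pr fine_ge0. Qed.

Lemma pr_set0 : pr P set0 = 0.
Proof. by rewrite /pr measure0. Qed.

Lemma pr_setT : pr P setT = 1.
Proof. by rewrite /pr probability_setT. Qed.

Lemma prU A B : measurable A -> measurable B -> A `&` B = set0 ->
  pr P (A `|` B) = pr P A + pr P B.
Proof.
move=> mA mB AB; apply: EFin_inj.
rewrite EFinD -!prE ?measureU //; exact: measurableU.
Qed.

Lemma prD A B : measurable A -> measurable B -> B `<=` A ->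
  pr P (A `\` B) = pr P A - pr P B.
Proof.
move=> mA mB BA; apply/eqP; rewrite eq_sym subr_eq addrC.
rewrite -prU //; [|exact: measurableD|by rewrite setDIK].
by rewrite setDUK.
Qed.

Lemma le_pr A B : measurable A -> measurable B -> A `<=` B ->
  pr P A <= pr P B.
Proof.
by move=> mA mB AB; rewrite -subr_ge0 -prD // pr_ge0.
Qed.

Lemma pr_le1 A : measurable A -> pr P A <= 1.
Proof. by move=> mA; rewrite -pr_setT le_pr. Qed.

Lemma pr_setC A : measurable A -> pr P (~` A) = 1 - pr P A.
Proof. by move=> mA; rewrite -setTD prD // pr_setT. Qed.

Definition fmeasurable (E : finType) (q : Omega -> E) :=
  forall e, measurable [set w | q w = e].

Lemma fmeasurable_set (E : finType) (q : Omega -> E) (H : E -> Prop) :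
  fmeasurable q -> measurable [set w | H (q w)].
Proof.
move=> mq; rewrite (_ : mkset _ = \bigcup_(e in H) [set w | q w = e]).
  by apply: fin_bigcup_measurable => // e _; exact: mq.
by apply/seteqP; split=> [w /= Hw|w [e He /= ->] //]; exists (q w).
Qed.

Lemma fmeasurable_pair (E F : finType) (q : Omega -> E) (r : Omega -> F) :
  fmeasurable q -> fmeasurable r -> fmeasurable (fun w => (q w, r w)).
Proof.
move=> mq mr [e f].
rewrite (_ : mkset _ = [set w | q w = e] `&` [set w | r w = f]).
  exact: measurableI.
by apply/seteqP; split=> w /= [-> ->].
Qed.

Lemma pr_fin (E : finType) (q : Omega -> E) (H : pred E) : fmeasurable q ->
  pr P [set w | H (q w)] = \sum_(e | H e) pr P [set w | q w = e].
Proof.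
move=> mq.
pose S (s : seq E) := [set w | (q w \in s) && H (q w)].
have mS s : measurable (S s).
  exact: (fmeasurable_set (fun e => (e \in s) && H e)).
rewrite (_ : mkset _ = S (index_enum E)); last first.
  by apply/seteqP; split=> w; rewrite /S /= mem_index_enum.
elim: (index_enum E) (index_enum_uniq E) => [_|e s IH /= /andP[es us]].
  rewrite big_nil (_ : S [::] = set0) ?pr_set0 //.
  by apply/seteqP; split=> w.
rewrite big_cons -IH //; case: ifPn => He.
  rewrite -prU //.
    congr (pr P _); apply/seteqP; split=> w; rewrite /S /= inE.
      move=> /andP[/orP[/eqP ->|ws] Hw]; first by left.
      by right; rewrite ws.
    by case=> [->|/andP[-> ->]]; rewrite ?eqxx ?orbT.
  apply/seteqP; split=> w //= [qe]; rewrite /S /= qe.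
  by move/andP=> [es']; rewrite es' in es.
congr (pr P _); apply/seteqP; split=> w; rewrite /S /= inE; last first.
  by move=> /andP[-> ->]; rewrite orbT.
by move=> /andP[/orP[/eqP qe|->] //]; rewrite qe (negbTE He).
Qed.

Definition samelaw (E : finType) (q q' : Omega -> E) :=
  forall e, pr P [set w | q w = e] = pr P [set w | q' w = e].

Lemma samelaw_comp (E F : finType) (q q' : Omega -> E) (h : E -> F) :
  fmeasurable q -> fmeasurable q' -> samelaw q q' ->
  samelaw (fun w => h (q w)) (fun w => h (q' w)).
Proof.
move=> mq mq' qq' f.
have E1 (r : Omega -> E) :
    [set w | h (r w) = f] = [set w | [pred e | h e == f] (r w)].
  by apply/seteqP; split=> w /= /eqP.
by rewrite !E1 !pr_fin //; apply: eq_bigr => e _; exact: qq'.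
Qed.

Hypothesis atomlessP : atomless P.

Lemma halve A : measurable A -> 0 < pr P A ->
  exists B, [/\ measurable B, B `<=` A, 0 < pr P B & pr P B * 2 <= pr P A].
Proof.
move=> mA A0; have [|B [mB BA B0 BlA]] := atomlessP mA.
  by rewrite prE // lte_fin.
move: B0 BlA; rewrite !prE // !lte_fin => B0 BlA.
have [h|h] := leP (pr P B * 2) (pr P A); first by exists B.
exists (A `\` B); split; first exact: measurableD.
- by move=> w [].
- by rewrite prD // subr_gt0.
- rewrite prD //; lra.
Qed.

Lemma small_subset A n : measurable A -> 0 < pr P A ->
  exists B, [/\ measurable B, B `<=` A, 0 < pr P B &
    pr P B * n.+1%:R <= pr P A].
Proof.
move=> mA A0; elim: n => [|n [B [mB BA B0 Bn]]].
  by exists A; split; rewrite ?mulr1.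
have [C [mC CB C0 Cn]] := halve mB B0.
exists C; split => //; first exact: subset_trans BA.
apply: le_trans Bn; apply: (@le_trans _ _ (pr P C * 2 * n.+1%:R)).
  rewrite -mulrA ler_pM2l // -natrM ler_nat; lia.
by rewrite ler_pM2r.
Qed.

Lemma greedy_extension A p B : measurable A -> measurable B ->
    B `<=` A -> pr P B <= p ->
  exists D, [/\ measurable D, D `<=` A `\` B, pr P B + pr P D <= p &
    forall D', measurable D' -> D' `<=` A `\` B -> pr P B + pr P D' <= p ->
      pr P D' <= pr P D * 2].
Proof.
move=> mA mB BA Bp.
pose S := [set x | exists D, [/\ measurable D, D `<=` A `\` B,
  pr P B + pr P D <= p & x = pr P D]].
have S0 : S 0.
  by exists set0; split => //; rewrite ?pr_set0 ?addr0.
have ubS : has_ubound S.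
  by exists 1 => x [D [mD _ _ ->]]; exact: pr_le1.
have supS : has_sup S by split => //; exists 0.
have leS D : measurable D -> D `<=` A `\` B -> pr P B + pr P D <= p ->
    pr P D <= sup S.
  by move=> mD DA Dp; apply: ub_le_sup => //; exists D.
have [s0|s0] := leP (sup S) 0.
  exists set0; split; rewrite ?pr_set0 ?addr0 ?mul0r // => D mD DA Dp.
  exact: le_trans (leS _ mD DA Dp) _.
have [||x [D [mD DA Dp ->]] xs] := @sup_adherent _ S (sup S / 2) => //.
  by rewrite divr_gt0.
exists D; split => // D' mD' DA' Dp'; apply: (le_trans (leS _ mD' DA' Dp')).
lra.
Qed.

(* Greedy exhaustion: repeatedly add an admissible piece of at least half the
   largest possible measure; a gap would leave room for a fixed small piece at
   every stage. *)
Lemma sierpinski A p : measurable A -> 0 <= p <= pr P A ->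
  exists B, [/\ measurable B, B `<=` A & pr P B = p].
Proof.
move=> mA /andP[p0 pA].
pose good B := [/\ measurable B, B `<=` A & pr P B <= p].
have /choice[f Hf] : forall B, exists D, good B -> [/\ measurable D,
    D `<=` A `\` B, pr P B + pr P D <= p &
    forall D', measurable D' -> D' `<=` A `\` B -> pr P B + pr P D' <= p ->
      pr P D' <= pr P D * 2].
  move=> B; case: (pselect (good B)) => [[mB BA Bp]|nB]; last by exists set0.
  by have [D HD] := greedy_extension mA mB BA Bp; exists D.
pose F n := iter n (fun B => B `|` f B) set0.
have gF n : good (F n) /\ pr P (F n.+1) = pr P (F n) + pr P (f (F n)).
  have step B : good B -> good (B `|` f B) /\
      pr P (B `|` f B) = pr P B + pr P (f B).
    move=> gB; have [mB BA Bp] := gB; have [mf fA fp _] := Hf _ gB.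
    have E : pr P (B `|` f B) = pr P B + pr P (f B).
      rewrite prU //; apply/seteqP; split=> w //= [Bw /fA[]] //.
    split=> //; split; [exact: measurableU| |by rewrite E].
    by move=> w [/BA|/fA[]].
  suff g : good (F n) by split => //; have [] := step _ g.
  elim: n => [|n IH]; last by have [] := step _ IH.
  by split; rewrite /F /= ?pr_set0.
have mF n : measurable (F n) by have [[]] := gF n.
have FA n : F n `<=` A by have [[]] := gF n.
have Fp n : pr P (F n) <= p by have [[]] := gF n.
have mU : measurable (\bigcup_n F n) by exact: bigcup_measurable.
have UA : \bigcup_n F n `<=` A by move=> w [n _ /FA].
have Up : pr P (\bigcup_n F n) <= p.
  rewrite -lee_fin -prE //.
  have /cvg_lim <- // : P \o F @ \oo --> P (\bigcup_n F n).
    apply: nondecreasing_cvg_mu => //; apply/nondecreasing_seqP => n.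
    by apply/subsetPset => w Fw; left.
  apply: lime_le.
    apply: ereal_nondecreasing_is_cvgn; apply/nondecreasing_seqP => n /=.
    apply: le_measure; rewrite ?inE; [exact: mF|exact: (mF n.+1)|].
    by move=> w; left.
  by near=> n; rewrite /= prE // lee_fin.
have [Ulp|pU] := ltP (pr P (\bigcup_n F n)) p; last first.
  by exists (\bigcup_n F n); split => //; apply/eqP; rewrite eq_le Up.
exfalso; have mAU := measurableD mA mU.
have AU0 : 0 < pr P (A `\` \bigcup_n F n) by rewrite prD //; lra.
have gap0 : 0 < p - pr P (\bigcup_n F n) by lra.
have [D [mD DA D0 Dsmall]] :=
  @small_subset _ (Num.truncn (p - pr P (\bigcup_n F n))^-1) mAU AU0.
have Dgap : pr P D <= p - pr P (\bigcup_n F n).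
  have := truncnS_gt (p - pr P (\bigcup_n F n))^-1.
  have := pr_le1 mAU; set x := (_ .+1%:R); set g := p - _ in gap0 *.
  move=> A1 gx; have : 1 < x * g by rewrite -ltr_pdivrMr // div1r.
  have xD : pr P D * x <= 1 by apply: le_trans A1.
  move=> xg; rewrite leNgt; apply/negP => gD.
  have x0 : 0 < x by rewrite ltr0n.
  have : x * g < x * pr P D by rewrite ltr_pM2l.
  lra.
have fD n : pr P D <= pr P (f (F n)) * 2.
  have [_ _ _ H] := Hf _ (proj1 (gF n)); apply: H => //.
    by move=> w /DA[Aw nU]; split => // Fw; apply: nU; exists n.
  have : pr P (F n) <= pr P (\bigcup_n F n).
    by apply: le_pr => //; exact: bigcup_sup.
  lra.
have Fn n : n%:R * pr P D <= pr P (F n) * 2.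
  elim: n => [|n IH]; first by rewrite mul0r mulr_ge0 ?pr_ge0.
  have := fD n; rewrite (proj2 (gF n)) -natr1; lra.
have := truncnS_gt (2 / pr P D); rewrite ltr_pdivrMr //.
have := Fn (Num.truncn (2 / pr P D)).+1.
have := pr_le1 (mF (Num.truncn (2 / pr P D)).+1).
lra.
Unshelve. all: by end_near.
Qed.

Lemma split_event (C : finType) (Q : set Omega) (s : seq C) (k : C -> R) :
    measurable Q -> uniq s -> s != [::] -> (forall c, 0 <= k c) ->
    \sum_(c <- s) k c = pr P Q ->
  exists r : Omega -> C, [/\ fmeasurable r, forall w, r w \in s &
    forall c, c \in s -> pr P (Q `&` [set w | r w = c]) = k c].
Proof.
move=> + + + k0; elim: s Q => // c s IH Q mQ /= /andP[cs us] _.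
rewrite big_cons; case: (eqVneq s [::]) => [-> |sn] sumQ.
  exists (fun=> c); split=> [e|w|e]; rewrite ?mem_head //.
    rewrite (_ : mkset _ = if c == e then setT else set0); first by case: ifP.
    by apply/seteqP; split=> w /=; case: eqP.
  rewrite inE => /eqP ->; move: sumQ; rewrite big_nil addr0 => ->.
  by congr (pr P _); apply/seteqP; split=> w // [].
have [|B [mB BQ Bc]] := @sierpinski Q (k c) mQ.
  by rewrite k0 -sumQ lerDl sumr_ge0.
have mQB : measurable (Q `\` B) by exact: measurableD.
have [|r [mr rs rk]] := IH (Q `\` B) mQB us sn.
  by rewrite prD // -sumQ Bc addrAC subrr add0r.
exists (fun w => if w \in B then c else r w); split.
- move=> e; rewrite (_ : mkset _ =
      (B `&` (if c == e then setT else set0)) `|` (~` B `&` [set w | r w = e])).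
    apply: measurableU; apply: measurableI => //; last exact: measurableC.
    by case: ifP.
  apply/seteqP; split=> w /=.
    case: ifPn => [/set_mem Bw ce|/negP nB re]; last first.
      by right; split => // Bw; apply: nB; exact: mem_set.
    by left; split => //; rewrite ce eqxx.
  case=> [[Bw]|[nB re]]; last by rewrite memNset.
  by rewrite mem_set //; case: eqP.
- by move=> w; case: ifP => _; rewrite ?mem_head // inE rs orbT.
move=> e; rewrite inE; case: eqVneq => [-> _|ec /= es].
  rewrite -Bc; congr (pr P _); apply/seteqP; split=> w /=.
    case=> Qw; case: ifPn => [/set_mem //|_ rc].
    by have := rs w; rewrite rc (negbTE cs).
  by move=> Bw; split; [exact: BQ|rewrite mem_set].
rewrite -rk //; congr (pr P _); apply/seteqP; split=> w /=.
  case=> Qw; case: ifPn => [_ ce|/negP nB re]; first by rewrite ce eqxx in ec.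
  by split => //; split => // Bw; apply: nB; exact: mem_set.
by case=> [[Qw nB] re]; split => //; rewrite memNset.
Qed.

Lemma prescribed_joint_law (E C : finType) (q : Omega -> E) (c0 : C)
    (S : E -> pred C) (k : E -> C -> R) :
    fmeasurable q -> (forall e c, 0 <= k e c) ->
    (forall e c, ~~ S e c -> k e c = 0) ->
    (forall e, \sum_c k e c = pr P [set w | q w = e]) ->
    (forall w, exists c, S (q w) c) ->
  exists r : Omega -> C, [/\ fmeasurable r, forall w, S (q w) (r w) &
    forall e c, pr P [set w | (q w, r w) = (e, c)] = k e c].
Proof.
move=> mq k0 kS sumk HS.
have /choice[f Hf] : forall e, exists r : Omega -> C, [/\ fmeasurable r,
    forall w, q w = e -> S e (r w) &
    forall c, pr P ([set w | q w = e] `&` [set w | r w = c]) = k e c].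
  move=> e; have kE : \sum_(c <- enum (S e)) k e c = pr P [set w | q w = e].
    rewrite -sumk big_enum [RHS](bigID (S e)) /= [X in _ = _ + X]big1.
      by rewrite addr0; apply: eq_bigl => c.
    exact: kS.
  case: (eqVneq (enum (S e)) [::]) => Se.
    have nS c : ~~ S e c.
      apply/negP => Sc; have := mem_enum (S e) c; rewrite Se => /esym.
      by rewrite inE -topredE /= Sc.
    have nq w : q w <> e.
      by move=> qe; have [c] := HS w; rewrite qe (negbTE (nS c)).
    exists (fun=> c0); split=> [c|w /nq //|c].
      rewrite (_ : mkset _ = if c0 == c then setT else set0).
        by case: ifP.
      by apply/seteqP; split=> w /=; case: eqP.
    rewrite kS // (_ : _ `&` _ = set0) ?pr_set0 //.
    by apply/seteqP; split=> w // [/nq].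
  have [r [mr rs rk]] := split_event (mq e) (enum_uniq _) Se (k0 e) kE.
  exists r; split => // [w _|c]; first by have := rs w; rewrite mem_enum.
  have [Sc|nSc] := boolP (S e c); first by rewrite rk // mem_enum.
  rewrite kS // (_ : _ `&` _ = set0) ?pr_set0 //.
  apply/seteqP; split=> w //= [_ rc]; have := rs w.
  by rewrite mem_enum rc -topredE /= (negbTE nSc).
have E2 e c : [set w | (q w, f (q w) w) = (e, c)] =
    [set w | q w = e] `&` [set w | f e w = c].
  apply/seteqP; split=> w /=; first by case=> -> ->.
  by case=> -> ->.
exists (fun w => f (q w) w); split.
- move=> c; rewrite (_ : mkset _ = \bigcup_(e in setT)
     ([set w | q w = e] `&` [set w | f e w = c])).
    apply: fin_bigcup_measurable => // e _; apply: measurableI => //.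
    by have [+ _ _] := Hf e; apply.
  apply/seteqP; split=> w /=; first by exists (q w).
  by case=> e _ [<-].
- by move=> w; have [_ + _] := Hf (q w); apply.
- by move=> e c; rewrite E2; have [_ _] := Hf e.
Qed.

Lemma coupling (E C : finType) (q q' : Omega -> E) (r : Omega -> C) (c0 : C)
    (S : E -> pred C) :
    fmeasurable q -> fmeasurable q' -> fmeasurable r -> samelaw q q' ->
    (forall w, S (q w) (r w)) -> (forall w, exists c, S (q' w) c) ->
  exists r' : Omega -> C, [/\ fmeasurable r', forall w, S (q' w) (r' w) &
    samelaw (fun w => (q w, r w)) (fun w => (q' w, r' w))].
Proof.
move=> mq mq' mr qq' HS HS'.
have mqr := fmeasurable_pair mq mr.
have [||e|r' [mr' Sr' Hr']] := @prescribed_joint_law _ _ q' c0 S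
  (fun e c => pr P [set w | (q w, r w) = (e, c)]) mq' _ _ _ HS'.
- by move=> e c; exact: pr_ge0.
- move=> e c nS; rewrite (_ : mkset _ = set0) ?pr_set0 //.
  apply/seteqP; split=> w //= [qe rc]; have := HS w.
  by rewrite qe rc (negbTE nS).
- rewrite -qq'.
  have -> : [set w | q w = e] = [set w | [pred x | x.1 == e] (q w, r w)].
    by apply/seteqP; split=> w /= /eqP.
  rewrite (pr_fin [pred x | x.1 == e] mqr) /=.
  transitivity (\sum_(x | x == e) \sum_c pr P [set w | (q w, r w) = (x, c)]).
    by rewrite big_pred1_eq.
  by rewrite pair_big /=; apply: eq_big => [x|[x c]] //; rewrite andbT.
- by exists r'; split => // -[e c]; rewrite Hr'.
Qed.

End Probability.

(** * Quantifier elimination in nice randomizations *)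

Section NiceRandomization.
Context (R : realType) (L : signature) (M : structure L).
Context (X : randomization R M).
Local Notation N := (randomization_interp X).
Local Notation Pr := (pr (rprob X)).

Definition rvar (a : sortK N) : romega X -> M := proj1_sig a.
Definition evset (B : sortB N) : set (romega X) := proj1_sig B.

Lemma evset_measurable B : measurable (evset B).
Proof. exact: (proj2_sig B). Qed.

Definition rtuple k (x : 'I_k -> sortK N) (w : romega X) : 'I_k -> M :=
  fun i => rvar (x i) w.

Definition evbits l (y : 'I_l -> sortB N) (w : romega X) :
    {ffun 'I_l -> bool} :=
  [ffun j => `[< evset (y j) w >]].

Lemma rtuple_tcons k a (x : 'I_k -> sortK N) w :
  rtuple (tcons a x) w = tcons (rvar a w) (rtuple x w).
Proof. exact: (tcons_comp (fun b => rvar b w)). Qed.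

Lemma evbits_tcons l B (y : 'I_l -> sortB N) w :
  evbits (tcons B y) w = [ffun j => tcons `[< evset B w >] (evbits y w) j].
Proof.
apply/ffunP => j; rewrite !ffunE.
have /(congr1 (@^~ j)) /= -> := tcons_comp (fun C => `[< evset C w >]) B y.
congr (_ j); by congr tcons; apply/funext => i; rewrite ffunE.
Qed.

Lemma fodef_measurable k (P : forall M : structure L, ('I_k -> M) -> Prop)
    (x : 'I_k -> sortK N) :
  fodef P -> measurable [set w | P M (rtuple x w)].
Proof.
case=> phi Hphi.
have := rmeasurable phi (fun i => proj2_sig (x i)).
congr measurable; apply/seteqP; split=> w; rewrite /random_event /=.
  by move/Hphi.
by move/Hphi.
Qed.

Lemma cmap_fmeasurable k (g : classifier L k) (x : 'I_k -> sortK N) :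
  fmeasurable (fun w => g M (rtuple x w)).
Proof. by move=> c; exact: fodef_measurable (cmap_def c). Qed.

Lemma evset_fmeasurable (B : sortB N) : fmeasurable (fun w => `[< evset B w >]).
Proof.
have mB := evset_measurable B; case.
  rewrite (_ : mkset _ = evset B) //.
  by apply/seteqP; split=> w /= => [/asboolP|/asboolT].
rewrite (_ : mkset _ = ~` evset B); first exact: measurableC.
by apply/seteqP; split=> w /= => [/asboolPn|/asboolF].
Qed.

Lemma evbits_fmeasurable l (y : 'I_l -> sortB N) : fmeasurable (evbits y).
Proof.
move=> e.
rewrite (_ : mkset _ =
    \bigcap_(j in setT) [set w | `[< evset (y j) w >] = e j]).
  by apply: fin_bigcap_measurable => // j _; exact: evset_fmeasurable.
apply/seteqP; split=> w /=; first by move=> <- j _; rewrite /= ffunE.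
by move=> H; apply/ffunP => j; rewrite ffunE H.
Qed.

Definition trace k l (g : classifier L k) (x : 'I_k -> sortK N)
    (y : 'I_l -> sortB N) (w : romega X) : cls g * {ffun 'I_l -> bool} :=
  (g M (rtuple x w), evbits y w).

Lemma trace_fmeasurable k l (g : classifier L k) x (y : 'I_l -> sortB N) :
  fmeasurable (trace g x y).
Proof.
by apply: fmeasurable_pair; [exact: cmap_fmeasurable|exact: evbits_fmeasurable].
Qed.

Hypothesis niceX : nice X.

Lemma nice_inhabited : inhabited (sortK N).
Proof. by case: niceX => -[]. Qed.

Lemma nice_atomless : atomless (rprob X).
Proof. by case: niceX. Qed.

Lemma nice_witness k (P : forall M : structure L, ('I_k.+1 -> M) -> Prop)
    (x : 'I_k -> sortK N) : fodef P ->
  exists a : sortK N, forall w, (exists u, P M (tcons u (rtuple x w))) ->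
    P M (tcons (rvar a w) (rtuple x w)).
Proof.
case=> phi Hphi; case: niceX => _ _ _ full _.
have [a Ka E] := full _ phi _ (fun i => proj2_sig (x i)).
exists (exist _ a Ka) => w [u Pu].
have : random_event (FEx phi) (fun i => proj1_sig (x i)) w.
  by exists u; apply/Hphi.
rewrite -E /random_event /= => /Hphi; congr P.
exact: (tcons_comp (fun b : romega X -> M => b w)).
Qed.

Lemma nice_glue (B : set (romega X)) (a1 a2 : sortK N) : measurable B ->
  exists a : sortK N, forall w,
    (B w -> rvar a w = rvar a1 w) /\ (~ B w -> rvar a w = rvar a2 w).
Proof.
case: niceX => _ _ events _ _ /events [n [psi [b [Kb ->]]]].
pose b' i : sortK N := exist _ (b i) (Kb i).
pose s (i : 'I_n) := lift ord0 (lift ord0 (lift ord0 i)).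
pose P (M' : structure L) (v : 'I_n.+3 -> M') :=
  (sat psi (fun i => v (s i)) /\ v ord0 = v (lift ord0 ord0)) \/
  (~ sat psi (fun i => v (s i)) /\ v ord0 = v (lift ord0 (lift ord0 ord0))).
have defP : fodef P.
  have defs := fodef_rename s (fodef_sat psi).
  by apply: fodef_or; apply: fodef_and => //;
    [exact: fodef_eq|exact: fodef_not|exact: fodef_eq].
have [a Ha] := nice_witness (tcons a1 (tcons a2 b')) defP.
exists a => w; have := Ha w.
have PE u : P M (tcons u (rtuple (tcons a1 (tcons a2 b')) w)) <->
    (random_event psi b w /\ u = rvar a1 w) \/
    (~ random_event psi b w /\ u = rvar a2 w).
  rewrite !rtuple_tcons /P tcons0 !tconsS !tcons0.
  suff -> : (fun i => tcons u (tcons (rvar a1 w)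
    (tcons (rvar a2 w) (rtuple b' w))) (s i)) = (fun i => b i w) by [].
  by apply/funext => i; rewrite /s !tconsS.
have [Bw|nB] := pselect (random_event psi b w).
  case/(_ _)/PE => [|[_ ->]|[]//]; last by split.
  by exists (rvar a1 w); apply/PE; left.
case/(_ _)/PE => [|[]//|[_ ->]]; last by split.
by exists (rvar a2 w); apply/PE; right.
Qed.

Lemma nice_glue_fin (C : finType) (a_ : C -> sortK N) (r : romega X -> C) :
  fmeasurable r -> exists a : sortK N, forall w, rvar a w = rvar (a_ (r w)) w.
Proof.
move=> mr.
suff [a Ha] : exists a : sortK N, forall w, r w \in enum C ->
    rvar a w = rvar (a_ (r w)) w.
  by exists a => w; apply: Ha; rewrite mem_enum.
elim: (enum C) => [|c s [a IH]].
  by have [a] := nice_inhabited; exists a.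
have [a' Ha'] := nice_glue (a_ c) a (mr c).
exists a' => w; have [Hc Hs] := Ha' w; rewrite inE.
have [rc _|rc /= rs] := eqVneq (r w) c; first by rewrite Hc ?rc.
by rewrite Hs ?IH //; apply/eqP.
Qed.

Lemma nice_select k (C : finType)
    (P : C -> forall M : structure L, ('I_k.+1 -> M) -> Prop)
    (r : romega X -> C) (x : 'I_k -> sortK N) :
  (forall c, fodef (P c)) -> fmeasurable r ->
  (forall w, exists u, P (r w) M (tcons u (rtuple x w))) ->
  exists a : sortK N, forall w, P (r w) M (tcons (rvar a w) (rtuple x w)).
Proof.
move=> defP mr HP.
have /choice[a_ Ha_] : forall c, exists a : sortK N, forall w,
    (exists u, P c M (tcons u (rtuple x w))) ->
    P c M (tcons (rvar a w) (rtuple x w)).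
  by move=> c; exact: nice_witness.
have [a Ha] := nice_glue_fin a_ mr.
by exists a => w; rewrite Ha; apply: Ha_.
Qed.

Lemma romega_inhabited : exists w : romega X, True.
Proof.
have [w _] : @setT (romega X) !=set0; last by exists w.
apply/set0P/eqP => E; have := @probability_setT _ _ _ (rprob X).
by rewrite E measure0 => /eqP; rewrite eq_sym onee_eq0.
Qed.

End NiceRandomization.

Definition extC (L : signature) k (g : classifier L k.+1) : classifier L k :=
  Classifier (set_classifier (fun c => fodef_ex (@cmap_def L k.+1 g c))).

Lemma in_extC (L : signature) k (g : classifier L k.+1) (M : structure L)
    (v : 'I_k -> M) c :
  (c \in extC g M v) <-> exists u, g M (tcons u v) = c.
Proof. by rewrite inE; split=> /asboolP. Qed.

Lemma back_and_forth_K (R : realType) (L : signature) (M : structure L)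
    (X : randomization R M) (niceX : nice X) k l (g : classifier L k.+1)
    (x x' : 'I_k -> sortK (randomization_interp X))
    (y y' : 'I_l -> sortB (randomization_interp X)) a :
  samelaw (rprob X) (trace (extC g) x y) (trace (extC g) x' y') ->
  exists a', samelaw (rprob X) (trace g (tcons a x) y)
                               (trace g (tcons a' x') y').
Proof.
move=> xx'.
pose q := trace (extC g) x y; pose q' := trace (extC g) x' y'.
pose r w := g M (rtuple (tcons a x) w).
have mq : fmeasurable q by exact: trace_fmeasurable.
have mq' : fmeasurable q' by exact: trace_fmeasurable.
have mr : fmeasurable r by exact: cmap_fmeasurable.
have [w0 _] := romega_inhabited X.
pose S (e : cls (extC g) * {ffun 'I_l -> bool}) (c : cls g) := c \in e.1.
have [||r' [mr' Sr' law]] :=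
  coupling (nice_atomless niceX) (r w0) (S := S) mq mq' mr xx'.
- by move=> w; apply/in_extC; exists (rvar a w); rewrite -rtuple_tcons.
- move=> w; have [u] := carrier_inhabited M.
  by exists (g M (tcons u (rtuple x' w))); apply/in_extC; exists u.
have [||a' Ha'] := @nice_select R L M X niceX k _
  (fun c M v => g M v = c) r' x' _ mr'.
- by move=> c; exact: cmap_def.
- by move=> w; apply/in_extC; have := Sr' w.
exists a'.
pose h (p : cls (extC g) * {ffun 'I_l -> bool} * cls g) := (p.2, p.1.2).
have -> : trace g (tcons a' x') y' = (fun w => h (q' w, r' w)).
  by apply/funext => w; rewrite /trace rtuple_tcons Ha'.
exact: (samelaw_comp h (fmeasurable_pair mq mr) (fmeasurable_pair mq' mr') law).
Qed.

Lemma back_and_forth_B (R : realType) (L : signature) (M : structure L)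
    (X : randomization R M) (niceX : nice X) k l (g : classifier L k)
    (x x' : 'I_k -> sortK (randomization_interp X))
    (y y' : 'I_l -> sortB (randomization_interp X)) B :
  samelaw (rprob X) (trace g x y) (trace g x' y') ->
  exists B', samelaw (rprob X) (trace g x (tcons B y))
                               (trace g x' (tcons B' y')).
Proof.
move=> xx'.
pose q := trace g x y; pose q' := trace g x' y'.
pose r w := `[< evset B w >].
have mq : fmeasurable q by exact: trace_fmeasurable.
have mq' : fmeasurable q' by exact: trace_fmeasurable.
have mr : fmeasurable r by exact: evset_fmeasurable.
have [||r' [mr' _ law]] :=
  coupling (nice_atomless niceX) true (S := fun _ _ => true) mq mq' mr xx'
  => //.
  by move=> w; exists true.
exists (exist _ _ (mr' true)).
pose h (p : cls g * {ffun 'I_l -> bool} * bool) :=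
  (p.1.1, [ffun j => tcons p.2 p.1.2 j]).
have -> : trace g x (tcons B y) = (fun w => h (q w, r w)).
  by apply/funext => w; rewrite /trace evbits_tcons.
have -> : trace g x' (tcons (exist _ _ (mr' true)) y') =
    (fun w => h (q' w, r' w)).
  apply/funext => w; rewrite /trace evbits_tcons /h /=.
  rewrite (_ : `[< _ >] = r' w) //.
  by apply/idP/idP => [/asboolP|/asboolT].
exact: (samelaw_comp h (fmeasurable_pair mq mr) (fmeasurable_pair mq' mr') law).
Qed.

Lemma bterm_classifier (R : realType) (L : signature) k l (t : bterm L k l) :
  exists (g : classifier L k) (h : cls g * {ffun 'I_l -> bool} -> bool),
  forall (M : structure L) (X : randomization R M)
      (x : 'I_k -> sortK (randomization_interp X))
      (y : 'I_l -> sortB (randomization_interp X)) w,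
    evset (bval x y t) w <-> h (trace g x y w).
Proof.
have def0 (c : unit) : @fodef L k (fun M v => tt = c).
  by case: c; apply: (fodef_iff _ (fodef_const L k True)).
pose C0 := Classifier def0.
elim: t => [j|n phi s|||t1 [g1 [h1 H1]] t2 [g2 [h2 H2]]
    |t1 [g1 [h1 H1]] t2 [g2 [h2 H2]]|t1 [g1 [h1 H1]]].
- exists C0, (fun p : cls C0 * {ffun 'I_l -> bool} => p.2 j) => M X x y w /=.
  by rewrite ffunE; split=> /asboolP.
- have [g [h H]] := fodef_classifier (fodef_rename s (fodef_sat phi)).
  by exists g, (fun p => h p.1) => M X x y w; apply: iff_sym; exact: H.
- by exists C0, (fun=> true).
- by exists C0, (fun=> false).
- exists (prodC g1 g2), (fun p => h1 (p.1.1, p.2) && h2 (p.1.2, p.2)).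
  move=> M X x y w /=; rewrite /evset /=.
  by split=> [[/H1 ? /H2 ?]|/andP[/H1 ? /H2 ?]]; first apply/andP.
- exists (prodC g1 g2), (fun p => h1 (p.1.1, p.2) || h2 (p.1.2, p.2)).
  move=> M X x y w /=; rewrite /evset /=; split.
    by case=> [/H1|/H2] H; apply/orP; [left|right].
  by move=> /orP[/H1|/H2]; [left|right].
- exists g1, (fun p => ~~ h1 p) => M X x y w /=; rewrite /evset /=.
  by split=> [H|/negP H]; [apply/negP => /H1|move=> /H1].
Qed.

Definition determines (R : realType) (L : signature) k l
    (g : classifier L k) (Phi : cformula R L k l) : Prop :=
  forall (M : structure L) (X : randomization R M), nice X ->
  forall (x x' : 'I_k -> sortK (randomization_interp X))
         (y y' : 'I_l -> sortB (randomization_interp X)),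
    samelaw (rprob X) (trace g x y) (trace g x' y') ->
    cval Phi x y = cval Phi x' y'.

Lemma samelaw_sym (R : realType) d (Omega : measurableType d)
    (P : probability Omega R) (E : finType) (q q' : Omega -> E) :
  samelaw P q q' -> samelaw P q' q.
Proof. by move=> H e. Qed.

Lemma samelaw_pr (R : realType) d (Omega : measurableType d)
    (P : probability Omega R) (E : finType) (q q' : Omega -> E)
    (H : E -> bool) : fmeasurable q -> fmeasurable q' -> samelaw P q q' ->
  pr P [set w | H (q w)] = pr P [set w | H (q' w)].
Proof. by move=> mq mq' qq'; apply: (samelaw_comp H mq mq' qq' true). Qed.

(* Quantifier elimination for nice randomizations.  It is exact and needs only
   finitely many first-order formulas, because a continuous formula is built from
   finitary connectives without uniform limits. *)
Lemma cformula_determined (R : realType) (L : signature) k l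
    (Phi : cformula R L k l) : exists g : classifier L k, determines g Phi.
Proof.
elim: Phi => {k l} [k l t|k l t u|k l i j|k l n u Ps IH|k l P [g IH]
  |k l P [g IH]|k l P [g IH]|k l P [g IH]].
- have [g [h H]] := bterm_classifier R t.
  exists g => M X niceX x x' y y' xx' /=.
  have E z (v : 'I_l -> sortB (randomization_interp X)) :
      evset (bval z v t) = [set w | h (trace g z v w)].
    by apply/seteqP; split=> w /= Hw; apply/H.
  rewrite -/(pr _ _) -!/(evset _) !E.
  by apply: samelaw_pr => //; exact: trace_fmeasurable.
- have [g1 [h1 H1]] := bterm_classifier R t.
  have [g2 [h2 H2]] := bterm_classifier R u.
  exists (prodC g1 g2) => M X niceX x x' y y' xx' /=.
  pose h (p : cls (prodC g1 g2) * {ffun 'I_l -> bool}) :=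
    h1 (p.1.1, p.2) (+) h2 (p.1.2, p.2).
  have E z (v : 'I_l -> sortB (randomization_interp X)) :
      evset (bval z v t) `+` evset (bval z v u) =
      [set w | h (trace (prodC g1 g2) z v w)].
    have {}H1 w : evset (bval z v t) w = h1 (trace g1 z v w).
      by apply/propext; exact: H1.
    have {}H2 w : evset (bval z v u) w = h2 (trace g2 z v w).
      by apply/propext; exact: H2.
    apply/seteqP; split=> w; rewrite /h /= /setY /= !H1 !H2 /trace.
      by case=> -[]; [move=> -> /negP/negbTE -> | move=> -> /negP/negbTE ->].
    by case: (h1 _); case: (h2 _) => //= _; [left|right].
  rewrite -/(pr _ _) -!/(evset _) !E.
  by apply: samelaw_pr => //; exact: trace_fmeasurable.
- have [g [h0 H]] := fodef_classifier (fodef_eq L i j).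
  exists g => M X niceX x x' y y' xx' /=.
  pose h (p : cls g * {ffun 'I_l -> bool}) := ~~ h0 p.1.
  have E z (v : 'I_l -> sortB (randomization_interp X)) :
      [set w | rvar (z i) w <> rvar (z j) w] =
      [set w | h (trace g z v w)].
    apply/seteqP; split=> w; rewrite /h /=.
      move=> ne; apply/negP => hv; apply: ne.
      exact: (proj1 (H M (rtuple z w)) hv).
    move=> /negP nh zij; apply: nh.
    exact: (proj2 (H M (rtuple z w)) zij).
  rewrite -/(pr _ _) -!/(rvar _) (E x y) (E x' y').
  by apply: samelaw_pr => //; exact: trace_fmeasurable.
- have /choice[g Hg] := IH.
  exists (ffunC g) => M X niceX x x' y y' xx' /=.
  congr (u _); apply/rowP => i; rewrite !mxE.
  apply: (Hg i) => //.
  pose h (p : cls (ffunC g) * {ffun 'I_l -> bool}) := (p.1 i, p.2).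
  have E z (v : 'I_l -> sortB (randomization_interp X)) :
      trace (g i) z v = (fun w => h (trace (ffunC g) z v w)).
    by apply/funext => w; rewrite /h /trace /= ffunE.
  by rewrite !E; apply: samelaw_comp => //; exact: trace_fmeasurable.
- exists (extC g) => M X niceX x x' y y' xx' /=.
  congr sup; apply/seteqP; split=> _ [a _ <-].
    have [a' aa'] := back_and_forth_K niceX a xx'.
    by exists a' => //; apply/esym/IH.
  have [a' aa'] := back_and_forth_K niceX a (samelaw_sym xx').
  by exists a' => //; apply/esym/IH.
- exists (extC g) => M X niceX x x' y y' xx' /=.
  congr inf; apply/seteqP; split=> _ [a _ <-].
    have [a' aa'] := back_and_forth_K niceX a xx'.
    by exists a' => //; apply/esym/IH.
  have [a' aa'] := back_and_forth_K niceX a (samelaw_sym xx').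
  by exists a' => //; apply/esym/IH.
- exists g => M X niceX x x' y y' xx' /=.
  congr sup; apply/seteqP; split=> _ [a _ <-].
    have [a' aa'] := back_and_forth_B niceX a xx'.
    by exists a' => //; apply/esym/IH.
  have [a' aa'] := back_and_forth_B niceX a (samelaw_sym xx').
  by exists a' => //; apply/esym/IH.
- exists g => M X niceX x x' y y' xx' /=.
  congr inf; apply/seteqP; split=> _ [a _ <-].
    have [a' aa'] := back_and_forth_B niceX a xx'.
    by exists a' => //; apply/esym/IH.
  have [a' aa'] := back_and_forth_B niceX a (samelaw_sym xx').
  by exists a' => //; apply/esym/IH.
Qed.

(** * Functional formulas from definability *)

Lemma fodef_atmost1 (L : signature) n
    (P : forall M : structure L, ('I_n.+1 -> M) -> Prop) :
  fodef P -> fodef (fun M v => forall u u',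
    P M (tcons u v) -> P M (tcons u' v) -> u = u').
Proof.
move=> defP.
pose Q (M : structure L) (v : 'I_n.+2 -> M) :=
  P M (fun i => v (lift ord0 i)) -> P M (fun i => v (rup (lift ord0) i)) ->
  v (lift ord0 ord0) = v ord0.
have defQ : fodef Q.
  apply: fodef_imp (fodef_rename _ defP) _.
  by apply: fodef_imp (fodef_rename _ defP) _; exact: fodef_eq.
apply: fodef_iff (fodef_all (fodef_all defQ)) => M v.
suff QE u u' : Q M (tcons u' (tcons u v)) <->
    (P M (tcons u v) -> P M (tcons u' v) -> u = u').
  by split=> H u u'; exact/QE/H.
rewrite /Q tconsS !tcons0 tcons_rup.
rewrite !tcons_tail //.
Qed.

Definition uniqC (L : signature) n (g : classifier L n.+1) : classifier L n :=
  Classifier (set_classifier (fun c => fodef_atmost1 (@cmap_def L n.+1 g c))).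

Lemma in_uniqC (L : signature) n (g : classifier L n.+1) (M : structure L)
    (v : 'I_n -> M) c :
  (c \in uniqC g M v) <->
  forall u u', g M (tcons u v) = c -> g M (tcons u' v) = c -> u = u'.
Proof. by rewrite inE; split=> /asboolP. Qed.

Definition renameC (L : signature) n m (s : 'I_n -> 'I_m) (g : classifier L n) :
    classifier L m :=
  Classifier (fun c => fodef_rename s (@cmap_def L n g c)).

Definition fiberC (L : signature) n (g : classifier L n.+1) : classifier L n :=
  prodC (uniqC g) (extC g).

Definition selects (L : signature) n (g : classifier L n.+1)
    (sigma : {ffun cls (fiberC g) -> cls g}) (M : structure L)
    (v : 'I_n.+1 -> M) : Prop :=
  let t := fiberC g M (fun i => v (lift ord0 i)) in
  g M v = sigma t /\ g M v \in t.1.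

Lemma fodef_selects (L : signature) n (g : classifier L n.+1) sigma :
  fodef (@selects L n g sigma).
Proof.
exact: (@fodef_cmap _ _ (prodC g (renameC (lift ord0) (fiberC g)))
  (fun p => p.1 = sigma p.2 /\ p.1 \in p.2.1)).
Qed.

Lemma selects_tcons (L : signature) n (g : classifier L n.+1) sigma
    (M : structure L) u (v : 'I_n -> M) :
  selects sigma (tcons u v) <->
  g M (tcons u v) = sigma (fiberC g M v) /\ g M (tcons u v) \in uniqC g M v.
Proof.
by rewrite /selects tcons_tail.
Qed.

Lemma selects_functional (L : signature) n (g : classifier L n.+1) sigma
    (M : structure L) u u' (v : 'I_n -> M) :
  selects (g := g) sigma (tcons u v) -> selects (g := g) sigma (tcons u' v) ->
  u = u'.
Proof.
move=> /selects_tcons[E /in_uniqC H] /selects_tcons[E' _].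
by apply: H; rewrite ?E ?E'.
Qed.

Lemma sum_pair (V : nmodType) (I J : finType) (f : I * J -> V) :
  \sum_x f x = \sum_i \sum_j f (i, j).
Proof. by rewrite pair_bigA; apply: eq_bigr => -[]. Qed.

Lemma exists_max_in (R : realType) (C : finType) (c0 : C) (A : {set C})
    (f : C -> R) :
  exists c, forall c', c' \in A -> c \in A /\ f c' <= f c.
Proof.
have [[c1 Ac1]|nA] := pselect (exists c, c \in A).
  exists [arg max_(c > c1 in A) f c]%O => c' Ac'.
  by case: arg_maxP => // c Ac maxc; split => //; exact: maxc.
by exists c0 => c Ac; case: nA; exists c.
Qed.

Lemma sum_sqr_le_max (R : realType) (C : finType) (A : {set C}) (c0 : C)
    (f : C -> R) :
  (forall c, 0 <= f c) ->
  (forall c, c \in A -> c0 \in A /\ f c <= f c0) ->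
  \sum_(c in A) f c * f c / \sum_c f c <= if c0 \in A then f c0 else 0.
Proof.
move=> f0 fmax; case: ifPn => c0A; last first.
  by rewrite big_pred0 // => c; apply/negP => /fmax[]; rewrite (negbTE c0A).
have s0 : 0 <= \sum_c f c by exact: sumr_ge0.
apply: (@le_trans _ _ (\sum_c f c0 * (f c / \sum_c f c))).
  rewrite [leLHS]big_mkcond; apply: ler_sum => c _.
  have fs : 0 <= f c / \sum_c f c by rewrite divr_ge0.
  case: ifP => [/fmax[_ fc]|_]; last by rewrite mulr_ge0.
  by rewrite -mulrA ler_wpM2r.
rewrite -mulr_sumr -mulr_suml ler_piMr //.
by have [->|s1] := eqVneq (\sum_c f c) 0; rewrite ?mul0r // divff.
Qed.

(* Let [T] be the fibre type of [a] and [r] the class of (b, a).  A conditionally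
   independent copy [r'] of [r] given [T] is realized by some [x'] that avoids [b]
   whenever it can.  As (x', a) and (b, a) have the same law, [x'] is within 2 eta
   of [b].  But [x' = b] forces [r' = r] to be realized by [b] only, and this is
   at most as probable as [r] being the likeliest such class given [T]. *)
Lemma nice_selects (R : realType) (L : signature) (M : structure L)
    (X : randomization R M) (niceX : nice X) n (g : classifier L n.+1)
    (Phi : cformula R L n.+1 0) (gPhi : determines g Phi)
    (b : sortK (randomization_interp X))
    (a : 'I_n -> sortK (randomization_interp X)) (eta : R) :
  (forall x, `|cval Phi (tcons x a) (@tnil _) - distK x b| <= eta) ->
  exists sigma, 1 - pr (rprob X)
    [set w | selects (g := g) sigma (rtuple (tcons b a) w)] <= eta + eta.
Proof.
move=> Hphi.
pose Pr := pr (rprob X).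
pose r w := g M (rtuple (tcons b a) w).
pose T w := fiberC g M (rtuple a w).
pose q w := (T w, r w).
have mr : fmeasurable r by exact: cmap_fmeasurable.
have mT : fmeasurable T by exact: cmap_fmeasurable.
have mq : fmeasurable q by exact: fmeasurable_pair.
pose p t c := Pr [set w | q w = (t, c)].
have p0 t c : 0 <= p t c by exact: pr_ge0.
pose s t := \sum_c p t c.
have s0 t : 0 <= s t by exact: sumr_ge0.
have ps t c : p t c * (s t / s t) = p t c.
  have [st|st] := eqVneq (s t) 0; last by rewrite divff ?mulr1.
  suff -> : p t c = 0 by rewrite mul0r.
  apply/eqP; rewrite eq_le p0 andbT -st /s (bigD1 c) //= lerDl.
  exact: sumr_ge0.
pose k (e : cls (fiberC g) * cls g) c' := p e.1 e.2 * p e.1 c' / s e.1.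
have [w0 _] := romega_inhabited X.
have rT w : r w \in (T w).2.
  by apply/in_extC; exists (rvar b w); rewrite -rtuple_tcons.
have [|||w|r' [mr' Sr' kr']] := @prescribed_joint_law _ _ _ (rprob X)
    (nice_atomless niceX) _ _ q (r w0) (fun e c => c \in e.1.2) k mq.
- by move=> e c; rewrite !mulr_ge0 // invr_ge0.
- move=> [t c] c' /= nc'; rewrite /k /= (_ : p t c' = 0) ?mulr0 ?mul0r //.
  rewrite /p /Pr (_ : mkset _ = set0) ?pr_set0 //.
  apply/seteqP; split=> w // -[Tw rw].
  by have := rT w; rewrite Tw rw (negbTE nc').
- by move=> [t c]; rewrite /k /= -mulr_suml -mulr_sumr -mulrA ps.
- by exists (r w).
pose P c (M : structure L) (v : 'I_n.+2 -> M) :=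
  g M (fun i => v (rup (lift ord0) i)) = c /\
  (v ord0 <> v (lift ord0 ord0) \/
   c \in uniqC g M (fun i => v (lift ord0 (lift ord0 i)))).
have defP c : fodef (P c).
  apply: fodef_and; first exact: (fodef_rename (rup (lift ord0)) (cmap_def c)).
  apply: fodef_or; first exact: fodef_not (fodef_eq _ _ _).
  exact: (@fodef_cmap _ _
    (renameC (fun i => lift ord0 (lift ord0 i)) (uniqC g)) (fun U => c \in U)).
have PE c u w : P c M (tcons u (rtuple (tcons b a) w)) <->
    g M (tcons u (rtuple a w)) = c /\
    (u <> rvar b w \/ c \in uniqC g M (rtuple a w)).
  rewrite /P tcons0 tconsS tcons_rup rtuple_tcons tcons0.
  rewrite tcons_tail.
  rewrite (_ : (fun i => tcons u (tcons (rvar b w) (rtuple a w))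
    (lift ord0 (lift ord0 i))) = rtuple a w) //.
  by apply/funext => i; rewrite !tconsS.
have [w|x' Hx'] := @nice_select R L M X niceX _ _ P r' (tcons b a) defP mr'.
  have /in_extC[u0 gu0] := Sr' w.
  have [ub|ub] := pselect (u0 = rvar b w); last first.
    by exists u0; apply/PE; split; [|left].
  have [c1|/negP nc1] := boolP (r' w \in uniqC g M (rtuple a w)).
    by exists u0; apply/PE; split; [|right].
  have [u [gu nu]] : exists u, g M (tcons u (rtuple a w)) = r' w /\ u <> u0.
    apply: contrapT => H; apply: nc1; apply/in_uniqC => u u' gu gu'.
    have u00 z : g M (tcons z (rtuple a w)) = r' w -> z = u0.
      by move=> gz; apply: contrapT => nz; apply: H; exists z.
    by rewrite (u00 u) // (u00 u').
  by exists u; apply/PE; split => //; left; rewrite -ub.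
have gx' w : g M (rtuple (tcons x' a) w) = r' w.
  by have /PE[+ _] := Hx' w; rewrite rtuple_tcons.
have law : samelaw (rprob X) r r'.
  move=> c'; pose q' w := (q w, r' w).
  have mq' : fmeasurable q' by exact: fmeasurable_pair.
  rewrite (_ : [set w | r' w = c'] = [set w | [pred x | x.2 == c'] (q' w)]);
    last by apply/seteqP; split=> w /= /eqP.
  rewrite (_ : [set w | r w = c'] = [set w | [pred x | x.2 == c'] (q w)]);
    last by apply/seteqP; split=> w /= /eqP.
  rewrite !pr_fin // big_mkcond [RHS]big_mkcond.
  rewrite [LHS]sum_pair [RHS]sum_pair [RHS]sum_pair /=; apply: eq_bigr => t _.
  under [RHS]eq_bigr do rewrite -big_mkcond big_pred1_eq kr' /k /=.
  rewrite -big_mkcond big_pred1_eq -!mulr_suml -/(s t).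
  by rewrite [RHS]mulrAC [RHS]mulrC ps.
have Phix' : cval Phi (tcons x' a) (@tnil _) = cval Phi (tcons b a) (@tnil _).
  apply: gPhi => //; pose h c : cls g * {ffun 'I_0 -> bool} :=
    (c, [ffun=> true]).
  have E x : trace g (tcons x a) (@tnil (sortB (randomization_interp X))) =
      fun w => h (g M (rtuple (tcons x a) w)).
    apply/funext => w; rewrite /trace /h; congr pair.
    by apply/ffunP => -[].
  rewrite !E; apply: samelaw_comp; [exact: cmap_fmeasurable..|].
  by rewrite (_ : (fun w => g M (rtuple (tcons x' a) w)) = r') ?funeqE //;
    exact: samelaw_sym.
have dx' : distK x' b <= eta + eta.
  have := Hphi x'; have := Hphi b; rewrite Phix'.
  have [[_ [_ -> _ _] _ _ _] _ _ _ _] := niceX.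
  rewrite subr0 !ler_norml => /andP[_ h1] /andP[h2 _]; lra.
have /choice[sig Hsig] : forall t : cls (fiberC g), exists c, forall c',
    c' \in t.1 -> c \in t.1 /\ p t c' <= p t c.
  by move=> t; exact: exists_max_in (r w0) _ _.
exists [ffun t => sig t].
have PrE : Pr [set w | selects [ffun t => sig t] (rtuple (tcons b a) w)] =
    \sum_(t : cls (fiberC g)) if sig t \in t.1 then p t (sig t) else 0.
  rewrite (_ : mkset _ =
      [set w | [pred e | (e.2 == sig e.1) && (e.2 \in e.1.1)] (q w)]).
    rewrite /Pr pr_fin // big_mkcond sum_pair; apply: eq_bigr => t _ /=.
    rewrite (bigD1 (sig t)) //= eqxx /= big1 ?addr0 // => c.
    by move=> /negbTE ->.
  apply/seteqP; split=> w /=; rewrite rtuple_tcons.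
    move=> /selects_tcons[E U]; rewrite ffunE in E.
    by apply/andP; split; [apply/eqP|]; rewrite /r rtuple_tcons.
  move=> /andP[/eqP E U]; apply/selects_tcons.
  by rewrite ffunE -rtuple_tcons.
have mEq : measurable [set w | rvar x' w = rvar b w].
  have := fodef_measurable (tcons x' (tcons b a))
    (fodef_eq L ord0 (lift ord0 ord0)).
  by congr measurable; apply/seteqP; split=> w;
     rewrite /= !rtuple_tcons tcons0 tconsS tcons0.
have PrEq : Pr [set w | rvar x' w = rvar b w] <=
    \sum_(t : cls (fiberC g)) \sum_(c in t.1) p t c * p t c / s t.
  have mq' : fmeasurable (fun w => (q w, r' w)) by exact: fmeasurable_pair.
  pose H (x : cls (fiberC g) * cls g * cls g) :=
    (x.2 == x.1.2) && (x.2 \in x.1.1.1).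
  apply: (@le_trans _ _ (Pr [set w | H (q w, r' w)])).
    apply: le_pr => //.
      exact: (fmeasurable_set (fun x => H x) mq').
    move=> w /= xb; have /PE[gr [//|r1]] := Hx' w.
    by apply/andP; split=> //; apply/eqP; rewrite /= -gr xb /r rtuple_tcons.
  rewrite /Pr pr_fin // big_mkcond 2!sum_pair; apply: ler_sum => t _.
  rewrite [leRHS]big_mkcond; apply: ler_sum => c _ /=.
  rewrite /H /= (bigD1 c) //= eqxx /= big1 ?addr0 => [|c' /negbTE -> //].
  by rewrite kr'.
have dE : distK x' b = 1 - Pr [set w | rvar x' w = rvar b w].
  by rewrite /Pr -pr_setC.
have : \sum_(t : cls (fiberC g)) \sum_(c in t.1) p t c * p t c / s t <=
    \sum_(t : cls (fiberC g)) if sig t \in t.1 then p t (sig t) else 0.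
  by apply: ler_sum => t _; exact: (sum_sqr_le_max (p0 t) (Hsig t)).
rewrite -/Pr PrE; lra.
Qed.

(** * Transfer to models of T^R *)

Section Connectives.
Context (R : realType).

Lemma coordB_continuous :
  continuous (fun x : 'rV[R]_2 => x 0 0 - x 0 1 : R^o).
Proof.
move=> x; apply: (@continuousB R R^o _ (fun x : 'rV[R]_2 => x 0 0)
  (fun x : 'rV[R]_2 => x 0 1)); exact: coord_continuous.
Qed.

Lemma conn_sub_proof : {within @unit_cube R 2, continuous
  (fun x : 'rV[R]_2 => Num.max 0 (x 0 0 - x 0 1) : R)}.
Proof.
apply: continuous_subspaceT => x.
apply: (@continuous_max R _ (fun=> 0)
  (fun x : 'rV[R]_2 => x 0 0 - x 0 1 : R^o)).
  exact: cst_continuous.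
exact: coordB_continuous.
Qed.

Lemma conn_sub_unit (x : 'rV[R]_2) :
  unit_cube x -> 0 <= Num.max 0 (x 0 0 - x 0 1) <= 1.
Proof.
move=> Hx; have /andP[a0 a1] := Hx 0; have /andP[b0 b1] := Hx 1.
rewrite le_max lexx /= ge_max ler01 /=; lra.
Qed.

Definition conn_sub : connective R 2 := Connective conn_sub_proof conn_sub_unit.

Lemma conn_dist_proof : {within @unit_cube R 2, continuous
  (fun x : 'rV[R]_2 => `|x 0 0 - x 0 1| : R)}.
Proof.
apply: continuous_subspaceT => x.
apply: (continuous_comp (f := fun x : 'rV[R]_2 => x 0 0 - x 0 1 : R^o)).
  exact: coordB_continuous.
exact: norm_continuous.
Qed.

Lemma conn_dist_unit (x : 'rV[R]_2) :
  unit_cube x -> 0 <= `|x 0 0 - x 0 1| <= 1.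
Proof.
move=> Hx; have /andP[a0 a1] := Hx 0; have /andP[b0 b1] := Hx 1.
rewrite normr_ge0 ler_norml; lra.
Qed.

Definition conn_dist : connective R 2 :=
  Connective conn_dist_proof conn_dist_unit.

Lemma conn_mul_proof : {within @unit_cube R 2, continuous
  (fun x : 'rV[R]_2 => x 0 0 * x 0 1 : R)}.
Proof.
apply: continuous_subspaceT => x.
apply: (@continuousM R _ (fun x : 'rV[R]_2 => x 0 0)
  (fun x : 'rV[R]_2 => x 0 1)); exact: coord_continuous.
Qed.

Lemma conn_mul_unit (x : 'rV[R]_2) :
  unit_cube x -> 0 <= x 0 0 * x 0 1 <= 1.
Proof.
move=> Hx; have /andP[a0 a1] := Hx 0; have /andP[b0 b1] := Hx 1.
by rewrite mulr_ge0 // mulr_ile1.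
Qed.

Definition conn_mul : connective R 2 := Connective conn_mul_proof conn_mul_unit.

Lemma conn_one_proof : {within @unit_cube R 0, continuous (fun=> 1 : R)}.
Proof. by apply: continuous_subspaceT => x; exact: cst_continuous. Qed.

Lemma conn_one_unit (x : 'rV[R]_0) : unit_cube x -> 0 <= (1 : R) <= 1.
Proof. by rewrite ler01 lexx. Qed.

Definition conn_one : connective R 0 := Connective conn_one_proof conn_one_unit.

Context (L : signature).

Definition CConn2 k l (u : connective R 2) (Phi Psi : cformula R L k l) :=
  CConn u (fun i => if i == 0 then Phi else Psi).

Definition COne k l : cformula R L k l :=
  CConn conn_one (fun i => False_rect _ (notF (ltn_ord i))).

(* The distance of an event to the sure event is its probability of failing. *)
Definition CFail k n (phi : formula L n) (s : 'I_n -> 'I_k) :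
    cformula R L k 0 := CDistB R (BEvent 0 phi s) (BTop L k 0).

End Connectives.

Section PreStructure.
Context (R : realType) (L : signature) (N : rand_interp R L).

Lemma cval_sub k l (Phi Psi : cformula R L k l) x (y : 'I_l -> sortB N) :
  cval (CConn2 (conn_sub R) Phi Psi) x y =
  Num.max 0 (cval Phi x y - cval Psi x y).
Proof. by rewrite /= !mxE. Qed.

Lemma cval_dist k l (Phi Psi : cformula R L k l) x (y : 'I_l -> sortB N) :
  cval (CConn2 (conn_dist R) Phi Psi) x y = `|cval Phi x y - cval Psi x y|.
Proof. by rewrite /= !mxE. Qed.

Lemma cval_mul k l (Phi Psi : cformula R L k l) x (y : 'I_l -> sortB N) :
  cval (CConn2 (conn_mul R) Phi Psi) x y = cval Phi x y * cval Psi x y.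
Proof. by rewrite /= !mxE. Qed.

Definition failure n (phi : formula L n) (v : 'I_n -> sortK N) : R :=
  distB (event phi v) (btop N).

Lemma cval_fail k n (phi : formula L n) (s : 'I_n -> 'I_k) x
    (y : 'I_0 -> sortB N) :
  cval (CFail R phi s) x y = failure phi (fun i => x (s i)).
Proof. by []. Qed.

Hypothesis preN : is_prestructure N.

Lemma distK_pseudo : is_pseudometric (@distK R L N).
Proof. by case: preN. Qed.

Lemma distB_pseudo : is_pseudometric (@distB R L N).
Proof. by case: preN. Qed.

Lemma range_sup_inf_unit (X : Type) (f : X -> R) : inhabited X ->
  (forall x, 0 <= f x <= 1) ->
  0 <= sup (range f) <= 1 /\ 0 <= inf (range f) <= 1.
Proof.
move=> [x0] f01.
have ne : range f !=set0 by exists (f x0); exists x0.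
have ub : ubound (range f) 1 by move=> _ [x _ <-]; case/andP: (f01 x).
have lb : lbound (range f) 0 by move=> _ [x _ <-]; case/andP: (f01 x).
have fs : f x0 <= sup (range f) by apply: ub_le_sup; [exists 1|exists x0].
have fi : inf (range f) <= f x0 by apply: ge_inf; [exists 0|exists x0].
have /andP[h0 h1] := f01 x0; split; apply/andP; split.
- exact: le_trans fs.
- exact: ge_sup.
- exact: lb_le_inf.
- exact: le_trans h1.
Qed.

Lemma cval_unit k l (Phi : cformula R L k l) x (y : 'I_l -> sortB N) :
  0 <= cval Phi x y <= 1.
Proof.
have [inK [dK01 _ _ _] [dB01 _ _ _] mu01 _] := preN.
have inB : inhabited (sortB N) by constructor; exact: btop.
elim: Phi x y => {k l} [k l t|k l t u|k l i j|k l n u Ps IH|k l P IH|k l P IH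
  |k l P IH|k l P IH] x y //=.
- by apply: conn_unit => i; rewrite mxE.
- by have [] := range_sup_inf_unit inK (fun a => IH (tcons a x) y).
- by have [] := range_sup_inf_unit inK (fun a => IH (tcons a x) y).
- by have [] := range_sup_inf_unit inB (fun B => IH x (tcons B y)).
- by have [] := range_sup_inf_unit inB (fun B => IH x (tcons B y)).
Qed.

Lemma le_CSupK k l (P : cformula R L k.+1 l) x (y : 'I_l -> sortB N) a :
  cval P (tcons a x) y <= cval (CSupK P) x y.
Proof.
apply: ub_le_sup; last by exists a.
by exists 1 => _ [b _ <-]; case/andP: (cval_unit P (tcons b x) y).
Qed.

Lemma CSupK_le k l (P : cformula R L k.+1 l) x (y : 'I_l -> sortB N) c :
  (forall a, cval P (tcons a x) y <= c) -> cval (CSupK P) x y <= c.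
Proof.
have [[a] _ _ _ _] := preN => H; apply: ge_sup => [|_ [b _ <-]]; last exact: H.
by exists (cval P (tcons a x) y); exists a.
Qed.

Lemma CInfK_le k l (P : cformula R L k.+1 l) x (y : 'I_l -> sortB N) a :
  cval (CInfK P) x y <= cval P (tcons a x) y.
Proof.
apply: ge_inf; last by exists a.
by exists 0 => _ [b _ <-]; case/andP: (cval_unit P (tcons b x) y).
Qed.

Lemma CInfK_lt k l (P : cformula R L k.+1 l) x (y : 'I_l -> sortB N) c :
  cval (CInfK P) x y < c -> exists a, cval P (tcons a x) y < c.
Proof.
have [[a] _ _ _ _] := preN => /inf_lt[|_ [b _ <-]]; last by exists b.
by exists (cval P (tcons a x) y); exists a.
Qed.

Lemma failure_ge0 n (phi : formula L n) v : 0 <= failure phi v.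
Proof. by have [/(_ (event phi v) (btop N))/andP[]] := distB_pseudo. Qed.

Lemma failure_lipschitz n (phi : formula L n.+1) (b c : sortK N) a :
  failure phi (tcons b a) <= distK b c + failure phi (tcons c a).
Proof.
have [_ [_ d0 _ _] [_ _ _ dtri] _ [_ _ _ _ lip]] := preN.
apply: le_trans (dtri _ (event phi (tcons c a)) _) _; rewrite lerD2r.
apply: le_trans (lip _ _ _ _) _; rewrite big_ord_recl !tcons0 big1 ?addr0 //.
by move=> i _; rewrite !tconsS d0.
Qed.

End PreStructure.

Section NiceFailure.
Context (R : realType) (L : signature) (M : structure L).
Context (X : randomization R M).
Local Notation N := (randomization_interp X).

Lemma failure_nice n (phi : formula L n) (v : 'I_n -> sortK N) :
  failure phi v = 1 - pr (rprob X) [set w | sat phi (rtuple v w)].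
Proof.
rewrite /failure /= -pr_setC; last first.
  exact: fodef_measurable (fodef_sat phi).
by congr (pr _ _); rewrite setYTC.
Qed.

Lemma failure_nice0 n (phi : formula L n) (v : 'I_n -> sortK N) :
  (forall w, sat phi (rtuple v w)) -> failure phi v = 0.
Proof.
move=> H; rewrite failure_nice (_ : mkset _ = setT) ?pr_setT ?subrr //.
by apply/seteqP; split=> w // _; exact: H.
Qed.

End NiceFailure.

Section Transfer.
Context (R : realType) (L : signature) (T : theory L) (N : rand_interp R L).
Hypothesis N_model : is_model_TR T N.

Lemma model_pre : is_prestructure N.
Proof. by case: N_model => -[]. Qed.

Let preN := model_pre.

Lemma transfer k (Phi : cformula R L k 0) :
  (forall (M : structure L) (X : randomization R M), is_model T M -> nice X ->
   forall x, cval Phi x (@tnil (sortB (randomization_interp X))) = 0) ->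
  forall x, cval Phi x (@tnil (sortB N)) = 0.
Proof.
elim: k Phi => [|k IH] Phi H x.
  rewrite (tnil_uniq x); have [_ HTR] := N_model.
  by apply: HTR => M X MT niceX; exact: H.
have sup0 : cval (CSupK Phi) (fun i => x (lift ord0 i)) (@tnil (sortB N)) = 0.
  apply: IH => M X MT niceX z.
  have preX : is_prestructure (randomization_interp X) by case: niceX.
  apply/eqP; rewrite eq_le (proj1 (andP (cval_unit preX _ _ _))) andbT.
  by apply: CSupK_le => // a; rewrite H.
apply/eqP; rewrite eq_le (proj1 (andP (cval_unit preN _ _ _))) andbT.
by rewrite -(tcons_eta x) -sup0 le_CSupK.
Qed.

Lemma max0_eq0 (x : R) : (Num.max 0 x = 0) <-> x <= 0.
Proof.
split=> [<-|x0]; first by rewrite le_max lexx orbT.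
by apply/eqP; rewrite eq_le ge_max lexx x0 /= le_max lexx.
Qed.

Lemma transfer_le k (Phi Psi : cformula R L k 0) :
  (forall (M : structure L) (X : randomization R M), is_model T M -> nice X ->
   forall x, cval Phi x (@tnil (sortB (randomization_interp X))) <=
             cval Psi x (@tnil (sortB (randomization_interp X)))) ->
  forall x, cval Phi x (@tnil (sortB N)) <= cval Psi x (@tnil (sortB N)).
Proof.
move=> H x; rewrite -subr_le0; apply/max0_eq0; rewrite -cval_sub.
apply: transfer => M X MT niceX z; rewrite cval_sub; apply/max0_eq0.
by rewrite subr_le0 H.
Qed.

Lemma transfer_exists (I : eqType) (s : seq I) k (Phi : I -> cformula R L k 0) :
  (forall (M : structure L) (X : randomization R M), is_model T M -> nice X ->
   forall x, exists2 i, i \in s &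
     cval (Phi i) x (@tnil (sortB (randomization_interp X))) = 0) ->
  forall x, exists2 i, i \in s & cval (Phi i) x (@tnil (sortB N)) = 0.
Proof.
pose F := foldr (fun i => CConn2 (conn_mul R) (Phi i)) (COne R L k 0) s.
have FE (N' : rand_interp R L) z :
    cval F z (@tnil (sortB N')) = 0 <->
    exists2 i, i \in s & cval (Phi i) z (@tnil (sortB N')) = 0.
  rewrite /F; elim: (s) => [|i t IH].
    by rewrite /=; split=> [/eqP|[]//]; rewrite oner_eq0.
  rewrite [foldr _ _ _]/= cval_mul; split.
    move=> /eqP; rewrite mulf_eq0 => /orP[/eqP Pi|/eqP/IH[j js Pj]].
      by exists i; rewrite ?mem_head.
    by exists j; rewrite // inE js orbT.
  case=> j; rewrite inE => /orP[/eqP -> ->|js Pj]; first by rewrite mul0r.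
  by rewrite (proj2 IH) ?mulr0 //; exists j.
move=> H x; apply/FE; apply: transfer => M X MT niceX z.
by apply/FE; exact: H.
Qed.

Lemma tcons_rup_tail (Y : Type) n (u v : Y) (a : 'I_n -> Y) :
  (fun i => tcons u (tcons v a) (rup (lift ord0) i)) = tcons u a.
Proof. by rewrite tcons_rup tcons_tail. Qed.

(* The finitely many [phi i] depend on [Phi] alone, so the approximation
   provided by [nice_selects] is a single sentence. *)
Lemma functional_approximation n (Phi : cformula R L n.+1 0) :
  exists (I : finType) (phi : I -> formula L n.+1),
    (forall i, functional T (phi i)) /\
    forall (b : sortK N) (a : 'I_n -> sortK N) (eta : R),
      (forall x,
        `|cval Phi (tcons x a) (@tnil (sortB N)) - distK x b| <= eta) ->
      exists i, failure (phi i) (tcons b a) <= eta + eta.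
Proof.
have [g gPhi] := cformula_determined Phi.
have /choice[phi Hphi] := @fodef_selects L n g.
exists {ffun cls (fiberC g) -> cls g}, phi; split.
  by move=> i M MT v u u' /Hphi + /Hphi; exact: selects_functional.
pose D : cformula R L n.+2 0 := CConn2 (conn_dist R)
  (crename Phi (rup (lift ord0))) (CDistK R L 0 ord0 (lift ord0 ord0)).
have DE (N' : rand_interp R L) (x b : sortK N') a :
    cval D (tcons x (tcons b a)) (@tnil (sortB N')) =
    `|cval Phi (tcons x a) (@tnil (sortB N')) - distK x b|.
  by rewrite cval_dist cval_rename tcons_rup_tail /= tcons0 tconsS tcons0.
pose C i : cformula R L n.+1 0 := CConn2 (conn_sub R)
  (CConn2 (conn_sub R) (CFail R (phi i) id) (CSupK D)) (CSupK D).
have CE (N' : rand_interp R L) i z :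
    cval (C i) z (@tnil (sortB N')) = Num.max 0 (Num.max 0
      (failure (phi i) z - cval (CSupK D) z (@tnil (sortB N')))
      - cval (CSupK D) z (@tnil (sortB N'))).
  by rewrite /C !cval_sub.
move=> b a eta Heta.
have [|i _] := @transfer_exists _ (enum {ffun cls (fiberC g) -> cls g})
    n.+1 C _ (tcons b a).
  move=> M X MT niceX z; rewrite -(tcons_eta z).
  set b' := z ord0; set a' := fun i => z (lift ord0 i).
  have preX : is_prestructure (randomization_interp X) by case: niceX.
  have [|sigma Hs] := @nice_selects R L M X niceX n g Phi gPhi b' a'
      (cval (CSupK D) (tcons b' a') (@tnil (sortB (randomization_interp X)))).
    by move=> x; rewrite -DE le_CSupK.
  exists sigma; first by rewrite mem_enum.
  rewrite CE; apply/max0_eq0; rewrite subr_le0 ge_max.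
  rewrite (proj1 (andP (cval_unit preX _ _ _))) andTb lerBlDr failure_nice.
  apply: le_trans Hs; rewrite lerD2l lerN2 (_ : mkset _ = mkset
    (fun w => sat (phi sigma) (rtuple (tcons b' a') w))) //.
  by apply/seteqP; split=> w /Hphi.
rewrite CE => /max0_eq0; rewrite subr_le0 ge_max => /andP[_ H].
have De : cval (CSupK D) (tcons b a) (@tnil (sortB N)) <= eta.
  by apply: CSupK_le => // x; rewrite DE.
by exists i; lra.
Qed.

Lemma distK_functional n (phi : formula L n.+1) (b c : sortK N) a :
  functional T phi ->
  distK b c <= failure phi (tcons b a) + failure phi (tcons c a).
Proof.
move=> fphi.
pose D : cformula R L n.+2 0 := CConn2 (conn_sub R)
  (CDistK R L 0 ord0 (lift ord0 ord0)) (CFail R phi (rup (lift ord0))).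
have DE (N' : rand_interp R L) (x y : sortK N') z :
    cval D (tcons x (tcons y z)) (@tnil (sortB N')) =
    Num.max 0 (distK x y - failure phi (tcons x z)).
  rewrite cval_sub cval_fail tcons_rup_tail /=.
  by rewrite tcons0 tconsS tcons0.
have EE (N' : rand_interp R L) (x y : sortK N') z :
    cval (CFail R phi (lift ord0)) (tcons x (tcons y z)) (@tnil (sortB N')) =
    failure phi (tcons y z).
  by rewrite cval_fail tcons_tail.
have := @transfer_le n.+2 D (CFail R phi (lift ord0)) _ (tcons b (tcons c a)).
rewrite DE EE ge_max => H.
suff /H/andP[_] : forall (M : structure L) (X : randomization R M),
    is_model T M -> nice X -> forall x,
    cval D x (@tnil (sortB (randomization_interp X))) <=
    cval (CFail R phi (lift ord0)) x (@tnil (sortB (randomization_interp X))).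
  by rewrite lerBlDl.
move=> M X MT niceX x.
rewrite -(tcons_eta x) -(tcons_eta (fun i => x (lift ord0 i))).
set b' := x ord0; set c' := x (lift ord0 ord0).
set a' := fun i => x (lift ord0 (lift ord0 i)).
have preX : is_prestructure (randomization_interp X) by case: niceX.
rewrite DE EE ge_max failure_ge0 // andTb lerBlDl !failure_nice.
pose S y := [set w | sat phi (rtuple (tcons y a') w)].
have mS y : measurable (S y) by exact: fodef_measurable (fodef_sat phi).
have mSC y : measurable (~` S y) by exact: measurableC.
have mE : measurable [set w | rvar b' w <> rvar c' w].
  have := fodef_measurable (tcons b' (tcons c' a'))
    (fodef_not (fodef_eq L ord0 (lift ord0 ord0))).
  by congr measurable; apply/seteqP; split=> w;
     rewrite /= !rtuple_tcons tcons0 tconsS tcons0.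
rewrite -!pr_setC; [|exact: mS..].
have bound : pr (rprob X) [set w | rvar b' w <> rvar c' w] <=
    pr (rprob X) (~` S b' `|` (~` S c' `\` ~` S b')).
  apply: le_pr => //.
    by apply: measurableU; last exact: measurableD.
  move=> w bc; apply: contrapT => nS; apply: bc.
  have Sb : S b' w by apply: contrapT => nSb; apply: nS; left.
  have Sc : S c' w.
    by apply: contrapT => nSc; apply: nS; right; split=> // nSb; exact: nSb.
  by move: Sb Sc; rewrite /S /= !rtuple_tcons; exact: fphi.
apply: le_trans bound _; rewrite prU ?lerD2l.
- by apply: le_pr; [exact: measurableD|exact: mSC|move=> w []].
- exact: mSC.
- exact: measurableD.
- by apply/seteqP; split=> w // [? []].
Qed.

Lemma failure0_top n (phi : formula L n) (v : 'I_n -> sortK N) :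
  failure phi v = 0 <-> event phi v = btop N.
Proof.
have [[_ [_ sepB] _ _] _] := N_model; split; first exact: sepB.
by rewrite /failure => ->; have [_ -> _ _] := distB_pseudo preN.
Qed.

Definition total_formula n (phi : formula L n.+1) : Prop :=
  forall M, is_model T M -> forall v : 'I_n -> M, exists u, sat phi (tcons u v).

Lemma total_near_witness n (phi : formula L n.+1) (a : 'I_n -> sortK N)
    (e : R) :
  total_formula phi -> 0 < e -> exists u, failure phi (tcons u a) < e.
Proof.
move=> tphi e0; apply: (@CInfK_lt _ _ _ preN _ _ (CFail R phi id) a (@tnil _)).
rewrite (@transfer _ (CInfK (CFail R phi id))) // => M X MT niceX x.
have preX : is_prestructure (randomization_interp X) by case: niceX.
have [u Hu] := nice_witness niceX x (fodef_sat phi).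
apply/eqP; rewrite eq_le (proj1 (andP (cval_unit preX _ _ _))) andbT.
apply: le_trans (CInfK_le preX _ x _ u) _.
rewrite cval_fail failure_nice0 // => w.
by rewrite rtuple_tcons; apply: Hu; exact: tphi.
Qed.

Lemma total_witness n (phi : formula L n.+1) (a : 'I_n -> sortK N) :
  functional T phi -> total_formula phi -> exists u, failure phi (tcons u a) = 0.
Proof.
move=> fphi tphi.
have /choice[u Hu] : forall j : nat,
    exists u, failure phi (tcons u a) < j.+1%:R^-1.
  by move=> j; apply: total_near_witness => //; rewrite invr_gt0.
have [[_ _ complK _] _] := N_model.
have small (e : R) : 0 < e -> exists j : nat, forall i, (j <= i)%N ->
    failure phi (tcons (u i) a) < e.
  move=> e0; have [j _ Hj] := near_infty_natSinv_lt (PosNum e0).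
  by exists j => i ji; apply: lt_trans (Hu i) _; exact: Hj.
have [e e0|x ux] := complK u.
  have [|j Hj] := small (e / 2); first by rewrite divr_gt0.
  exists j => i i' /Hj hi /Hj hi'.
  have := distK_functional (u i) (u i') a fphi; lra.
exists x; apply/eqP; rewrite eq_le (failure_ge0 preN) andbT.
apply/ler_addgt0Pr => e e0; rewrite add0r.
have [|j Hj] := small (e / 2); first by rewrite divr_gt0.
have [_ _ dsym _] := distK_pseudo preN.
have e20 : 0 < e / 2 by rewrite divr_gt0.
have /cvgr0_norm_lt/(_ _ e20)[j' _ Hj'] := ux.
have := Hj (maxn j j') (leq_maxl _ _).
have := le_lt_trans (ler_norm _) (Hj' (maxn j j') (leq_maxr _ _)).
have := failure_lipschitz preN phi x (u (maxn j j')) a; rewrite dsym; lra.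
Qed.

Lemma fo_definable_near n (phi : formula L n.+1) (A : set (sortK N)) b a :
  functional T phi -> total_formula phi -> (forall i, A (a i)) ->
  exists2 b', fo_definable T A b' & distK b' b <= failure phi (tcons b a).
Proof.
move=> fphi tphi Aa; have [b' Hb'] := total_witness a fphi tphi.
exists b'; first by exists n, phi, a; split => //; apply/failure0_top.
by have := distK_functional b' b a fphi; rewrite Hb' add0r.
Qed.

(* Where [phi] has no solution, return the first parameter. *)
Lemma functional_total_extension n (phi : formula L n.+2) : functional T phi ->
  exists phi' : formula L n.+2, [/\ functional T phi', total_formula phi' &
    forall v : 'I_n.+2 -> sortK N, failure phi' v <= failure phi v].
Proof.
move=> fphi.
pose P (M : structure L) (v : 'I_n.+2 -> M) := sat phi v \/
  (~ (exists u, sat phi (tcons u (fun i => v (lift ord0 i)))) /\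
   v ord0 = v (lift ord0 ord0)).
have [phi' Hphi'] : fodef P.
  apply: fodef_or; first exact: fodef_sat.
  apply: fodef_and; last exact: fodef_eq.
  exact: fodef_not (fodef_rename (lift ord0) (fodef_ex (fodef_sat phi))).
have PE (M : structure L) u (v : 'I_n.+1 -> M) : sat phi' (tcons u v) <->
    sat phi (tcons u v) \/ (~ (exists u, sat phi (tcons u v)) /\ u = v ord0).
  by rewrite Hphi' /P tcons_tail tcons0 tconsS.
exists phi'; split.
- move=> M MT v u u' /PE[pu|[nu ->]] /PE[pu'|[nu' ->]] //.
  + exact: fphi pu pu'.
  + by case: nu'; exists u.
  + by case: nu; exists u'.
- move=> M MT v; have [[u pu]|nu] := pselect (exists u, sat phi (tcons u v)).
    by exists u; apply/PE; left.
  by exists (v ord0); apply/PE; right.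
move=> v; apply: (@transfer_le n.+2 (CFail R phi' id) (CFail R phi id)).
move=> M X MT niceX x; rewrite !cval_fail !failure_nice lerD2l lerN2.
apply: le_pr; [exact: fodef_measurable (fodef_sat _)..|].
by move=> w /= pw; apply/Hphi'; left.
Qed.

Lemma fo_definable_near_functional (T_complete : complete_theory T) n
    (phi : formula L n.+1) (A : set (sortK N)) b a :
  functional T phi -> (forall i, A (a i)) -> failure phi (tcons b a) < 1 ->
  exists2 b', fo_definable T A b' & distK b' b <= failure phi (tcons b a).
Proof.
case: n phi a => [|n] phi a fphi Aa lt1; last first.
  have [phi' [f' t' le']] := functional_total_extension fphi.
  have [b' ? db'] := fo_definable_near b f' t' Aa.
  by exists b' => //; exact: le_trans db' (le' _).
have [_ /(_ (FEx phi))[ex|nex]] := T_complete.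
  apply: fo_definable_near => // M MT v.
  by rewrite (tnil_uniq v); exact: ex.
exfalso; move: lt1; apply/negP; rewrite -leNgt.
refine (@transfer_le 1 (COne R L 1 0) (CFail R phi id) _ (tcons b a)).
move=> M X MT niceX x.
rewrite cval_fail failure_nice (_ : mkset _ = set0).
  by rewrite pr_set0 subr0.
apply/seteqP; split=> w //= pw; apply: (nex M MT).
exists (rtuple x w ord0).
by rewrite -(tnil_uniq (fun i => rtuple x w (lift ord0 i))) tcons_eta.
Qed.

Lemma definable_cl_fdcl (T_complete : complete_theory T) (A : set (sortK N)) b :
  definable A b -> cl (fdcl T A) b.
Proof.
move=> [n [Phi [a [Aa lim]]]] e e0.
pose eta := Num.min (e / 3) (1 / 3).
have eta0 : 0 < eta by rewrite lt_min !divr_gt0.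
have [k _ /(_ k (leqnn k)) Hk] := lim eta eta0.
have [I [phi [fphi Hphi]]] := functional_approximation (Phi k).
have [x|i Hi] := Hphi b (a k) eta; first exact/ltW/Hk.
have [etae eta1] : eta <= e / 3 /\ eta <= 1 / 3.
  by rewrite /eta !ge_min !lexx orbT.
have [|b' fb' db'] := fo_definable_near_functional T_complete (b := b)
    (fphi i) (Aa k).
  by apply: le_lt_trans Hi _; lra.
exists b' => //; lra.
Qed.

Lemma fo_definable_dist (A : set (sortK N)) b : fo_definable T A b ->
  exists n (phi : formula L n.+1) (a : 'I_n -> sortK N),
    (forall i, A (a i)) /\
    forall x, failure phi (tcons x a) = distK x b.
Proof.
move=> [n [phi [a [fphi Aa /failure0_top pb]]]].
exists n, phi, a; split=> // x; apply/eqP; rewrite eq_le.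
have := failure_lipschitz preN phi x b a; rewrite pb addr0 => -> /=.
by have := distK_functional x b a fphi; rewrite pb addr0.
Qed.

Lemma cl_fdcl_sequence (A : set (sortK N)) b : cl (fdcl T A) b ->
  exists b_ : nat -> sortK N, forall m,
    fo_definable T A (b_ m) /\ distK (b_ m) b < m.+1%:R^-1.
Proof.
move=> clb; suff /choice[b_ Hb_] : forall m : nat, exists b' : sortK N,
    fo_definable T A b' /\ distK b' b < m.+1%:R^-1 by exists b_.
by move=> m; have [|b' ? ?] := clb m.+1%:R^-1; [rewrite invr_gt0|exists b'].
Qed.

Lemma cl_fdcl_definable (A : set (sortK N)) b :
  cl (fdcl T A) b -> definable A b.
Proof.
move=> /cl_fdcl_sequence[b_ Hb_].
have /choice[p Hp] : forall k,
    exists p : {n : nat & (formula L n.+1 * ('I_n -> sortK N))%type},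
    (forall i, A ((projT2 p).2 i)) /\
    forall x, failure (projT2 p).1 (tcons x (projT2 p).2) = distK x (b_ k).
  move=> k; have [n [phi [a H]]] := fo_definable_dist (proj1 (Hb_ k)).
  by exists (existT _ n (phi, a)).
exists (fun k => projT1 (p k)), (fun k => CFail R (projT2 (p k)).1 id),
  (fun k => (projT2 (p k)).2); split.
  by move=> k i; have [] := Hp k.
move=> e e0; have [j _ Hj] := near_infty_natSinv_lt (PosNum e0).
exists j => // k jk x; rewrite cval_fail (proj2 (Hp k)).
have [_ _ dsym dtri] := distK_pseudo preN.
apply: le_lt_trans (lt_trans (proj2 (Hb_ k)) (Hj k jk)).
rewrite ler_norml; have := dtri x (b_ k) b; have := dtri x b (b_ k).
rewrite (dsym b) => h1 h2; apply/andP; split; lra.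
Qed.

Lemma cl_fdcl_limit (A : set (sortK N)) b : cl (fdcl T A) b <->
  exists b_ : nat -> sortK N, (forall m, fo_definable T A (b_ m)) /\
    distK (b_ m) b @[m --> \oo] --> (0 : R).
Proof.
have [d01 _ _ _] := distK_pseudo preN.
split=> [/cl_fdcl_sequence[b_ Hb_]|[b_ [fb lim]] e e0].
  exists b_; split=> [m|]; first by have [] := Hb_ m.
  apply/cvgr0Pnorm_lt => e e0.
  have [j _ Hj] := near_infty_natSinv_lt (PosNum e0).
  exists j => // m jm; rewrite /= ger0_norm ?(proj1 (andP (d01 _ _))) //.
  exact: lt_trans (proj2 (Hb_ m)) (Hj m jm).
have /cvgr0_norm_lt/(_ _ e0)[j _ /(_ j (leqnn j)) Hj] := lim.
by exists (b_ j); [exact: fb|exact: le_lt_trans (ler_norm _) Hj].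
Qed.

End Transfer.

Theorem theorem3p18 (R : realType) (L : signature) (T : theory L)
    (T_complete : complete_theory T) (T_nontrivial : models_nontrivial T)
    (N : rand_interp R L) (N_model : is_model_TR T N)
    (A : set (sortK N)) (b : sortK N) :
  (definable A b <->
   exists b_ : nat -> sortK N,
     (forall m, fo_definable T A (b_ m)) /\
     distK (b_ m) b @[m --> \oo] --> (0 : R))
  /\ dcl A = cl (fdcl T A).
Proof.
have dclE c : definable A c <-> cl (fdcl T A) c.
  by split; [exact: definable_cl_fdcl|exact: cl_fdcl_definable].
split; last by apply/seteqP; split=> c /dclE.
by apply: iff_trans (dclE b) _; exact: cl_fdcl_limit.
Qed.
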